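(* There is a natural map $\widetilde{\Omega}\to\Omega$ (the one induced by the identity maps of the spaces $C_{1,r}\mathcal{H}(n)$, of which both sides are quotients) such that the composition $$\mathfrak{h}\xrightarrow{\ \widetilde{\mathrm{Tr}}\ }\widetilde{\Omega}\longrightarrow\Omega$$ is equal to $\mathrm{Tr}^{\mathrm{C}}\colon\mathfrak{h}\to\Omega$.
   Context: All vector spaces are over $\mathbb{Q}$. $H$ is a symplectic vector space of dimension $2g$ with nondegenerate skew-symmetric form $(\ \cdot\ )$. Hairy Lie graphs. A hairy Lie graph with $k$ trees is a disjoint union of $k$ unitrivalent trees (each with at least one trivalent vertex), numbered from $1$ to $k$, such that: each trivalent vertex carries a cyclic ordering of its three half-edges; some disjoint pairs of univalent vertices are each joined by an additional directed edge, called a dotted edge (not part of the trees); the remaining univalent vertices, called leaves, are colored with elements of $H$. The edge at a leaf is a hair. The Lie degree is the total number of trivalent vertices. $C_{k,r}\mathcal{H}^{\mathrm{ord}}(n)$ is the vector space spanned by hairy Lie graphs with $k$ (ordered) trees, $r$ dotted edges and Lie degree $n$, modulo: the AS relation (reversing the cyclic order at one trivalent vertex gives a minus sign); the IHX relation $I(A,B;C,D)+I(B,C;A,D)+I(C,A;B,D)=0$, where $I(A,B;C,D)$ denotes a graph having a tree edge $e$ whose two trivalent end vertices have cyclic orders $(e,A,B)$ and $(e,C,D)$, and the three graphs are identical elsewhere; multilinearity in the $H$-colorings; reversing the direction of a dotted edge gives a minus sign. For $k=1$ write $C_{1,r}\mathcal{H}(n)=C_{1,r}\mathcal{H}^{\mathrm{ord}}(n)$.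 $\mathfrak{h}(n):=C_{1,0}\mathcal{H}(n)$, $\mathfrak{h}=\bigoplus_{n\ge1}\mathfrak{h}(n)$. The map $\beta$ and $\widetilde{\Omega}$. For a hairy Lie graph $X$ with $k\ge 2$ ordered trees, in which all dotted edges between the first and second trees are directed from the first to the second, $\beta(X)$ is the sum, over all dotted edges joining the first and second trees, of the graph obtained by turning that dotted edge into a solid edge; the new tree is numbered first, and the others keep their order. The iterate $\beta^{n-1}$ maps $C_{n,n-1+r}\mathcal{H}^{\mathrm{ord}}(n)$ to $C_{1,r}\mathcal{H}(n)$. Set $\widetilde{\Omega}_r(n)=C_{1,r}\mathcal{H}(n)/\beta^{n-1}(C_{n,n-1+r}\mathcal{H}^{\mathrm{ord}}(n))$ and $\widetilde{\Omega}=\bigoplus_{n\ge1}\bigoplus_{r\ge1}\widetilde{\Omega}_r(n)$. The space $\Omega$. For $r\ge1$, $\Omega_r(n)$ is the quotient of $C_{1,r}\mathcal{H}(n)$ by the following relations, and $\Omega=\bigoplus_{n\ge1}\bigoplus_{r\ge1}\Omega_r(n)$. (C1) A graph in which a dotted edge joins two univalent vertices adjacent to the same trivalent vertex is $0$. (C2) A hair can be slid across a dotted edge: suppose a dotted edge is directed from a univalent vertex $X$ to a univalent vertex $Y$, and the tree edge at $X$ ends at a trivalent vertex $h$ carrying a hair colored $v\in H$, with cyclic order (third edge, hair, edge to $X$). Then the graph equals the one obtained by deleting $h$ and its hair (so the third edge now ends at $X$) and inserting in the tree edge ending at $Y$ a new trivalent vertex $h'$ with a hair colored $v$ and cyclic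 order (edge to $Y$, hair, other edge); the dotted edge is still directed from $X$ to $Y$. (C3) Given a disjoint union of a tripod (tree with one trivalent vertex) and another tree, with dotted edges, such that the three legs of the tripod are joined by three dotted edges, directed from the tripod, to three univalent vertices of the other tree: the sum of the three one-tree graphs obtained by turning exactly one of these three dotted edges into a solid edge is $0$. The traces. $\mathrm{Tr}_r\colon\mathfrak{h}(n)\to C_{1,r}\mathcal{H}(n)$ sends a tree to the sum, over all unordered collections of $r$ pairwise disjoint unordered pairs of its leaves, of the graph obtained by adding, for each chosen pair $\{l_1,l_2\}$ with colors $x_1,x_2$, a dotted edge directed from $l_1$ to $l_2$ (forgetting the colors) and multiplying by $(x_1\cdot x_2)$. $\widetilde{\mathrm{Tr}}\colon\mathfrak{h}\to\widetilde{\Omega}$ and $\mathrm{Tr}^{\mathrm{C}}\colon\mathfrak{h}\to\Omega$ are the compositions of $\bigoplus_{r\ge1}\mathrm{Tr}_r$ with the respective projections. *)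

(* Defs.v *)
From HB Require Import structures.
From mathcomp Require Import all_boot all_order all_algebra.
From mathcomp Require Import boolp freeg.

Set Implicit Arguments.
Unset Strict Implicit.
Unset Printing Implicit Defensive.
Import GRing.Theory.
Local Open Scope ring_scope.

Section Quotient.
Variables (R : nzRingType) (V : lmodType R) (S : V -> Prop).

Inductive span : V -> Prop :=
| span0 : span 0
| spanP a s v : S s -> span v -> span (a *: s + v).

Definition spanb : {pred V} := fun v => `[< span v >].

Lemma mem_span s : S s -> span s.
Proof. by move=> Ss; rewrite -[s]addr0 -[s]scale1r; apply: spanP Ss span0. Qed.

Lemma spanD u v : span u -> span v -> span (u + v).
Proof.
by elim=> [|a s w Ss _ IH] sv; rewrite ?add0r // -addrA; apply: spanP => //; apply: IH.
Qed.

Lemma spanZ a v : span v -> span (a *: v).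
Proof.
elim=> [|b s w Ss _ IH]; first by rewrite scaler0; apply: span0.
by rewrite scalerDr scalerA; apply: spanP.
Qed.

Lemma spanb_zmod_closed : zmod_closed spanb.
Proof.
split=> [|u v /asboolP su /asboolP sv]; apply/asboolP; first exact: span0.
by apply: spanD => //; rewrite -scaleN1r; apply: spanZ.
Qed.
HB.instance Definition _ := GRing.isZmodClosed.Build V spanb spanb_zmod_closed.

(* V / <S>; ring_quotient provides the quotient group only, so the scaling is
   added here. *)
Definition quotient : Type := Quotient.quot spanb.
HB.instance Definition _ := GRing.Zmodule.on quotient.

Definition proj (v : V) : quotient := \pi_(Quotient.quot spanb)%qT v.

Lemma projP u v : reflect (span (u - v)) (proj u == proj v).
Proof. by rewrite /proj -Quotient.idealrBE; apply: asboolP. Qed.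

Lemma reprq (q : quotient) : proj (repr q) = q.
Proof. exact: reprK. Qed.

Lemma proj_ind (P : quotient -> Prop) : (forall v, P (proj v)) -> forall q, P q.
Proof. by move=> h q; rewrite -[q]reprq. Qed.

Lemma proj_is_zmod_morphism : zmod_morphism proj.
Proof. by move=> u v; rewrite /proj raddfB. Qed.
HB.instance Definition _ :=
  GRing.isZmodMorphism.Build V quotient proj proj_is_zmod_morphism.

Definition qscale a (q : quotient) : quotient := proj (a *: repr q).

Lemma qscaleE a v : qscale a (proj v) = proj (a *: v).
Proof. by apply/eqP/projP; rewrite -scalerBr; apply/spanZ/projP; rewrite reprq. Qed.

Lemma qscaleA a b q : qscale a (qscale b q) = qscale (a * b) q.
Proof. by elim/proj_ind: q => v; rewrite !qscaleE scalerA. Qed.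

Lemma qscale1 : left_id 1 qscale.
Proof. by elim/proj_ind => v; rewrite !qscaleE scale1r. Qed.

Lemma qscaleDr : right_distributive qscale +%R.
Proof.
move=> a; elim/proj_ind => u; elim/proj_ind => v.
by rewrite !(qscaleE, =^~ raddfD) /= scalerDr.
Qed.

Lemma qscaleDl q : {morph qscale^~ q : a b / a + b}.
Proof.
by move=> a b; elim/proj_ind: q => v; rewrite !qscaleE -raddfD /= scalerDl.
Qed.

HB.instance Definition _ := GRing.Zmodule_isLmodule.Build R quotient
  qscaleA qscale1 qscaleDr qscaleDl.

Lemma proj_is_scalable : scalable proj.
Proof. by move=> a v; rewrite -qscaleE. Qed.
HB.instance Definition _ :=
  GRing.isScalable.Build R V quotient *:%R proj proj_is_scalable.

Lemma proj_eq0 s : S s -> proj s = 0.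
Proof.
by move=> Ss; apply/eqP; rewrite -(linear0 proj); apply/projP; rewrite subr0; apply: mem_span.
Qed.

End Quotient.

Arguments proj {R V} S.

Section QuotientLift.
Variables (R : nzRingType) (V W : lmodType R) (S : V -> Prop).
Variable f : {linear V -> W}.

(* The hypothesis is an argument so that the lift is canonically linear. *)
Definition qlift of (forall s, S s -> f s = 0) :=
  fun q : quotient S => f (repr q) : W.

Hypothesis f0 : forall s, S s -> f s = 0.

Lemma span_ker v : span S v -> f v = 0.
Proof.
by elim=> [|a s w /f0 fs _ IH]; rewrite ?linear0 // linearP fs IH scaler0 addr0.
Qed.

Lemma qliftE v : qlift f0 (proj S v) = f v.
Proof.
by apply/eqP; rewrite -subr_eq0 -linearB; apply/eqP/span_ker/projP; rewrite reprq.
Qed.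

Lemma qlift_is_linear : linear (qlift f0).
Proof.
by move=> a; elim/proj_ind => u; elim/proj_ind => v; rewrite -linearP !qliftE linearP.
Qed.
End QuotientLift.

HB.instance Definition _ (R : nzRingType) (V W : lmodType R) (S : V -> Prop)
    (f : {linear V -> W}) (f0 : forall s, S s -> f s = 0) :=
  GRing.isLinear.Build R (quotient S) W *:%R (qlift f0) (qlift_is_linear f0).

Section FreeLift.
Variables (R : nzRingType) (K : choiceType) (M : lmodType R) (f : K -> M).

Definition flift (D : {freeg K / R}) : M := fglift f D.

Lemma fliftU x : flift << x >> = f x.
Proof. by rewrite /flift liftU scale1r. Qed.

Lemma flift_is_zmod_morphism : zmod_morphism flift.
Proof. exact: lift_is_additive. Qed.
HB.instance Definition _ := GRing.isZmodMorphism.Build {freeg K / R} M flift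
  flift_is_zmod_morphism.

Lemma flift_is_scalable : scalable flift.
Proof.
move=> a D; have -> : a *: D = \sum_(x <- dom D) << a * coeff x D *g x >> by [].
have -> : flift D = \sum_(x <- dom D) flift << coeff x D *g x >>.
  by rewrite -raddf_sum freeg_sumE.
rewrite raddf_sum scaler_sumr /=.
by apply: eq_bigr => x _; rewrite /flift !liftU scalerA.
Qed.
HB.instance Definition _ := GRing.isScalable.Build R {freeg K / R} M *:%R flift
  flift_is_scalable.
End FreeLift.

Section DirectSum.
Variables (R : nzRingType) (I : eqType) (V : I -> lmodType R).

Record dsum := DSum {
  component :> forall i, V i;
  component_fin : exists s : seq I, forall i, i \notin s -> component i = 0 }.

HB.instance Definition _ := gen_eqMixin dsum.
HB.instance Definition _ := gen_choiceMixin dsum.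

Lemma dsumP (x y : dsum) : (forall i, x i = y i) -> x = y.
Proof.
case: x y => [f fP] [g gP] /= fg; have ? := functional_extensionality_dep fg.
by subst g; congr DSum; apply: Prop_irrelevance.
Qed.

Lemma dsum0_fin : exists s : seq I, forall i, i \notin s -> (0 : V i) = 0.
Proof. by exists [::]. Qed.

Lemma dsumN_fin (x : dsum) :
  exists s : seq I, forall i, i \notin s -> - x i = 0.
Proof. by have [s xs] := component_fin x; exists s => i /xs->; rewrite oppr0. Qed.

Lemma dsumD_fin (x y : dsum) :
  exists s : seq I, forall i, i \notin s -> x i + y i = 0.
Proof.
have [s xs] := component_fin x; have [t yt] := component_fin y.
exists (s ++ t) => i; rewrite mem_cat negb_or => /andP[/xs-> /yt->].
by rewrite addr0.
Qed.

Lemma dsumZ_fin a (x : dsum) :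
  exists s : seq I, forall i, i \notin s -> a *: x i = 0.
Proof. by have [s xs] := component_fin x; exists s => i /xs->; rewrite scaler0. Qed.

Definition dsum0 := DSum dsum0_fin.
Definition dsumN x := DSum (dsumN_fin x).
Definition dsumD x y := DSum (dsumD_fin x y).
Definition dsumZ a x := DSum (dsumZ_fin a x).

Lemma dsumDA : associative dsumD.
Proof. by move=> x y z; apply: dsumP => i /=; rewrite addrA. Qed.
Lemma dsumDC : commutative dsumD.
Proof. by move=> x y; apply: dsumP => i /=; rewrite addrC. Qed.
Lemma dsum0D : left_id dsum0 dsumD.
Proof. by move=> x; apply: dsumP => i /=; rewrite add0r. Qed.
Lemma dsumND : left_inverse dsum0 dsumN dsumD.
Proof. by move=> x; apply: dsumP => i /=; rewrite addNr. Qed.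
HB.instance Definition _ := GRing.isZmodule.Build dsum dsumDA dsumDC dsum0D dsumND.

Lemma dsumZA a b x : dsumZ a (dsumZ b x) = dsumZ (a * b) x.
Proof. by apply: dsumP => i /=; rewrite scalerA. Qed.
Lemma dsumZ1 : left_id 1 dsumZ.
Proof. by move=> x; apply: dsumP => i /=; rewrite scale1r. Qed.
Lemma dsumZDr : right_distributive dsumZ +%R.
Proof. by move=> a x y; apply: dsumP => i /=; rewrite scalerDr. Qed.
Lemma dsumZDl x : {morph dsumZ^~ x : a b / a + b}.
Proof. by move=> a b; apply: dsumP => i /=; rewrite scalerDl. Qed.
HB.instance Definition _ := GRing.Zmodule_isLmodule.Build R dsum
  dsumZA dsumZ1 dsumZDr dsumZDl.

Lemma dsum_in_fin i (v : V i) :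
  exists s : seq I, forall j, j \notin s -> dfwith (fun k => 0 : V k) v j = 0.
Proof.
exists [:: i] => j; rewrite inE eq_sym => ij; exact: dfwith_out.
Qed.

Definition dsum_in i (v : V i) := DSum (dsum_in_fin v).
End DirectSum.

Section Graphs.
Variable H : lmodType rat.

(* The half-edges of the trivalent vertices 0, ..., n-1; vertex v carries the
   cyclic order (v,0), (v,1), (v,2). *)
Definition hedge n := ('I_n * 'I_3)%type.
HB.instance Definition _ n := Finite.on (hedge n).

Definition next n (h : hedge n) : hedge n := (h.1, ordS h.2).

(* Where the tree edge containing a half-edge ends: at another trivalent
   vertex, at a univalent vertex of a dotted edge, or at a leaf.  Univalent
   vertices are named after the half-edge they are attached to; this loses
   nothing since every tree has a trivalent vertex.  In [Dotted out h'] the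
   other end of the dotted edge is the univalent vertex attached to h', and the
   dotted edge is directed towards h' iff [out]. *)
Inductive port n :=
| Solid of hedge n
| Dotted of bool & hedge n
| Hair of H.

Definition port_code n (p : port n) : hedge n + (bool * hedge n) + H :=
  match p with
  | Solid h => inl (inl h) | Dotted b h => inl (inr (b, h)) | Hair x => inr x
  end.
Definition port_decode n (c : hedge n + (bool * hedge n) + H) : port n :=
  match c with
  | inl (inl h) => Solid h | inl (inr (b, h)) => Dotted b h | inr x => Hair _ x
  end.
Lemma port_codeK n : cancel (@port_code n) (@port_decode n).
Proof. by case. Qed.
HB.instance Definition _ n := Choice.copy (port n) (can_type (@port_codeK n)).

Definition is_solid n (p : port n) := if p is Solid _ then true else false.
Definition is_dotted n (p : port n) := if p is Dotted _ _ then true else false.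
Definition is_hair n (p : port n) := if p is Hair _ then true else false.

Definition port_map n (f : hedge n -> hedge n) (p : port n) : port n :=
  match p with
  | Solid h => Solid (f h) | Dotted b h => Dotted b (f h) | Hair x => Hair _ x
  end.
Definition port_rev n (p : port n) : port n :=
  if p is Dotted b h then Dotted (~~ b) h else p.

(* [tree g v] is the number of the tree containing v; trees are numbered from
   0. *)
Record pregraph n k := Pregraph {
  att : {ffun hedge n -> port n};
  tree : {ffun 'I_n -> 'I_k} }.

Definition pregraph_code n k (g : pregraph n k) := (att g, tree g).
Definition pregraph_decode n k (c : _ * _) := @Pregraph n k c.1 c.2.
Lemma pregraph_codeK n k : cancel (@pregraph_code n k) (@pregraph_decode n k).
Proof. by case. Qed.
HB.instance Definition _ n k :=
  Choice.copy (pregraph n k) (can_type (@pregraph_codeK n k)).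

Definition consistent n k (g : pregraph n k) :=
  [forall h, match att g h with
             | Solid h' => [&& h' != h, att g h' == Solid h
                             & tree g h'.1 == tree g h.1]
             | Dotted b h' => att g h' == Dotted (~~ b) h
             | Hair _ => true
             end].

Definition adjacent n k (g : pregraph n k) : rel 'I_n :=
  fun u v => [exists i, exists j, att g (u, i) == Solid (v, j)].

Definition connected_trees n k (g : pregraph n k) :=
  [forall i, exists v, tree g v == i] &&
  [forall u, forall v, (tree g u == tree g v) ==> connect (adjacent g) u v].

(* Euler characteristic: k nonempty connected graphs with n vertices and n - k
   edges in total are trees. *)
Definition acyclic n k (g : pregraph n k) :=
  (#|[set h | is_solid (att g h)]| + k.*2 == n.*2)%N.

Definition hairy_lie n k r : pred (pregraph n k) := fun g =>
  [&& consistent g, connected_trees g, acyclic g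
    & (#|[set h | is_dotted (att g h)]| == r.*2)%N].

(* Hairy Lie graphs of Lie degree n with k ordered trees and r dotted edges. *)
Record hgraph k r n := HGraph { hg :> pregraph n k; hgP : hairy_lie r hg }.
HB.instance Definition _ k r n := [isSub for @hg k r n].
HB.instance Definition _ k r n := [Choice of hgraph k r n by <:].

Section Operations.
Variables (n k : nat).
Implicit Types (g : pregraph n k) (h : hedge n).

(* g' is obtained from g by moving whatever is attached to h to f h. *)
Definition relabelled (f : hedge n -> hedge n) g g' :=
  forall h, att g' (f h) = port_map f (att g h).

Definition isomorphic g g' := exists f : hedge n -> hedge n,
  [/\ injective f, forall h, f (next h) = next (f h), relabelled f g g'
    & forall h, tree g' (f h).1 = tree g h.1].

Definition flip_vertex (v : 'I_n) h : hedge n :=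
  if h.1 == v then (h.1, rev_ord h.2) else h.

Definition rotate3 a b c h : hedge n :=
  if h == a then c else if h == b then a else if h == c then b else h.

Definition set_hair h (x : H) g :=
  Pregraph [ffun y => if y == h then Hair n x else att g y] (tree g).

Definition reverse_edge h h' g := Pregraph
  [ffun y => if (y == h) || (y == h') then port_rev (att g y) else att g y]
  (tree g).
End Operations.

Section Space.
Variables (k r n : nat).
Implicit Types G : hgraph k r n.

Inductive graph_relation : {freeg (hgraph k r n) / rat} -> Prop :=
| rel_iso G G' : isomorphic G G' -> graph_relation (<< G >> - << G' >>)
| rel_as G G' v : relabelled (flip_vertex v) G G' -> tree G' = tree G ->
    graph_relation (<< G >> + << G' >>)
| rel_ihx G G' G'' h h' : att G h = Solid h' -> h.1 != h'.1 ->
    (* A, B, C are what is attached to next h, next (next h), next h'; trees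
       have no loops, so the vertices of h and h' always differ *)
    let f := rotate3 (next h) (next (next h)) (next h') in
    relabelled f G G' -> tree G' = tree G ->
    relabelled f G' G'' -> tree G'' = tree G' ->
    graph_relation (<< G >> + << G' >> + << G'' >>)
| rel_multilinear G G' G'' h a x y : att G h = Hair n (a *: x + y) ->
    hg G' = set_hair h x G -> hg G'' = set_hair h y G ->
    graph_relation (<< G >> - a *: << G' >> - << G'' >>)
| rel_direction G G' h b h' : att G h = Dotted b h' ->
    hg G' = reverse_edge h h' G -> graph_relation (<< G >> + << G' >>).

(* C_{k,r}H^ord(n) *)
Definition C := quotient graph_relation.

Definition gclass G : C := proj graph_relation << G >>.

(* Only used on well-formed graphs; see join_hairy and add_dotted_hairy. *)
Definition pclass (g : pregraph n k) : C :=
  if insub g is Some G then gclass G else 0.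
End Space.

Section ClassTheory.
Variables (k r n : nat).
Implicit Types g : pregraph n k.
Notation pc := (@pclass k r n).
Notation ok := (hairy_lie r).

Lemma pclassE g (gP : ok g) : pc g = gclass (HGraph gP).
Proof.
rewrite /pclass; case: insubP => [G _ /= Gg|]; last by rewrite gP.
by congr gclass; apply: val_inj.
Qed.

Lemma pclass_hg (G : hgraph k r n) : pc G = gclass G.
Proof. by rewrite (pclassE (hgP G)); congr gclass; apply: val_inj. Qed.

Lemma pclass_iso g g' : ok g -> ok g' -> isomorphic g g' -> pc g = pc g'.
Proof.
move=> gP g'P gg'; rewrite !pclassE; apply/eqP; rewrite -subr_eq0 -raddfB.
by apply/eqP/proj_eq0/rel_iso.
Qed.

Lemma pclass_as g g' v : ok g -> ok g' -> relabelled (flip_vertex v) g g' ->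
  tree g' = tree g -> pc g = - pc g'.
Proof.
move=> gP g'P gg' tg; rewrite !pclassE; apply/eqP; rewrite -addr_eq0 -raddfD.
by apply/eqP/proj_eq0/(rel_as (v := v)).
Qed.

Lemma pclass_ihx g g' g'' h h' : ok g -> ok g' -> ok g'' ->
  att g h = Solid h' -> h.1 != h'.1 ->
  let f := rotate3 (next h) (next (next h)) (next h') in
  relabelled f g g' -> tree g' = tree g ->
  relabelled f g' g'' -> tree g'' = tree g' -> pc g + pc g' + pc g'' = 0.
Proof.
move=> gP g'P g''P gh hh f *; rewrite !pclassE -!raddfD.
by apply/proj_eq0/(rel_ihx (h := h) (h' := h')).
Qed.

Lemma pclass_multilinear g g' g'' h a x y : ok g -> ok g' -> ok g'' ->
  att g h = Hair n (a *: x + y) -> g' = set_hair h x g -> g'' = set_hair h y g ->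
  pc g = a *: pc g' + pc g''.
Proof.
move=> gP g'P g''P gh eg' eg''; rewrite !pclassE; apply/eqP.
rewrite -subr_eq0 opprD addrA /gclass -linearZ /= -!raddfB /=.
by apply/eqP/proj_eq0/(rel_multilinear (h := h) (x := x) (y := y)).
Qed.

Lemma pclass_direction g g' h b h' : ok g -> ok g' ->
  att g h = Dotted b h' -> g' = reverse_edge h h' g -> pc g = - pc g'.
Proof.
move=> gP g'P gh eg'; rewrite !pclassE; apply/eqP; rewrite -addr_eq0 -raddfD.
by apply/eqP/proj_eq0/(rel_direction (h := h) (b := b) (h' := h')).
Qed.
End ClassTheory.

(* Merging the first two trees into the first one. *)
Definition merge k (i : 'I_k.+2) : 'I_k.+1 := inord i.-1.

(* Turns the dotted edge between h and h' into a solid edge. *)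
Definition join n k (h h' : hedge n) (g : pregraph n k.+2) : pregraph n k.+1 :=
  Pregraph
    [ffun y => if y == h then Solid h' else if y == h' then Solid h else att g y]
    [ffun v => merge (tree g v)].

Lemma mergeK k (i j : 'I_k.+2) : merge i = merge j ->
  [\/ i = j, i = 0 :> nat /\ j = 1%N :> nat | i = 1%N :> nat /\ j = 0 :> nat].
Proof.
move=> /(congr1 val); rewrite /= !inordK; last 2 first.
- by case: j => -[|j].
- by case: i => -[|i].
case: i j => [[|[|i]] iP] [[|[|j]] jP] //= ij; try by [constructor 2|constructor 3];
  by constructor 1; apply: val_inj => //=; rewrite ij.
Qed.

Lemma hairyP n k r (g : pregraph n k) : reflect
  [/\ consistent g, connected_trees g, acyclic g
    & #|[set h | is_dotted (att g h)]| = r.*2] (hairy_lie r g).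
Proof. by apply: (iffP and4P) => [[? ? ? /eqP]|[? ? ? /eqP]]; split. Qed.

Lemma consistent_solid n k (g : pregraph n k) h h' : consistent g ->
  att g h = Solid h' -> [/\ h' != h, att g h' = Solid h & tree g h'.1 = tree g h.1].
Proof. by move=> /forallP/(_ h) + gh; rewrite gh => /and3P[-> /eqP-> /eqP->]. Qed.

Lemma consistent_dotted n k (g : pregraph n k) h b h' : consistent g ->
  att g h = Dotted b h' -> att g h' = Dotted (~~ b) h /\ h' != h.
Proof.
move=> /forallP/(_ h) + gh; rewrite gh => /eqP gh'; split=> //.
by apply/eqP => hh; move: gh'; rewrite hh gh => -[]; case: b {gh}.
Qed.

Lemma join_hairy n k r (g : pregraph n k.+2) h b h' : hairy_lie r.+1 g ->
  att g h = Dotted b h' -> tree g h.1 = 0 :> nat -> tree g h'.1 = 1%N :> nat ->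
  hairy_lie r (join h h' g).
Proof.
move=> /hairyP[cg /andP[/forallP ne /forallP con] ag dg] gh th th'.
have [gh' h'h] := consistent_dotted cg gh.
have mm : merge (tree g h'.1) = merge (tree g h.1).
  by rewrite /merge th th'.
have sub : subrel (adjacent g) (connect (adjacent (join h h' g))).
  move=> u v /existsP[i /existsP[j /eqP gij]]; apply: connect1.
  apply/existsP; exists i; apply/existsP; exists j; rewrite ffunE.
  have [e|_] := eqVneq (u, i) h; first by rewrite -e gij in gh.
  by have [e|_] := eqVneq (u, i) h'; [rewrite -e gij in gh'|rewrite gij].
have jh : adjacent (join h h' g) h.1 h'.1.
  by apply/existsP; exists h.2; apply/existsP; exists h'.2; rewrite ffunE -!surjective_pairing eqxx.
have jh' : adjacent (join h h' g) h'.1 h.1.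
  apply/existsP; exists h'.2; apply/existsP; exists h.2.
  by rewrite ffunE -!surjective_pairing (negPf h'h) eqxx.
have con' u v : tree g u = tree g v -> connect (adjacent (join h h' g)) u v.
  move=> /eqP tuv; have /forallP/(_ v)/implyP/(_ tuv) := con u.
  exact: connect_sub.
apply/hairyP; split.
- apply/forallP => y; rewrite ffunE; case: eqP => [->|/eqP yh].
    by rewrite h'h !ffunE (negPf h'h) !eqxx /= mm.
  case: eqP => [->|/eqP yh'].
    by rewrite (eq_sym h) h'h !ffunE !eqxx /= mm eqxx.
  case gy: (att g y) => [z|c z|x] //.
    have [zy gz tz] := consistent_solid cg gy.
    rewrite zy !ffunE tz eqxx andbT.
    have [e|_] := eqVneq z h; first by rewrite e gh in gz.
    by have [e|_] := eqVneq z h'; [rewrite e gh' in gz|rewrite gz eqxx].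
  have [gz zy] := consistent_dotted cg gy.
  rewrite ffunE; have [e|_] := eqVneq z h.
    by move: gz yh'; rewrite e gh => -[_ ->]; rewrite eqxx.
  have [e|_] := eqVneq z h'; last by rewrite gz eqxx.
  by move: gz yh; rewrite e gh' => -[_ ->]; rewrite eqxx.
- apply/andP; split.
    apply/forallP => i; have iP : (i.+1 < k.+2)%N by rewrite ltnS; case: (i).
    have /existsP[v /eqP tv] := ne (Ordinal iP); apply/existsP; exists v.
    by rewrite ffunE tv; apply/eqP/val_inj; rewrite /= inordK.
  apply/forallP => u; apply/forallP => v; apply/implyP; rewrite !ffunE.
  move=> /eqP/mergeK[/con' //|[tu tv]|[tu tv]].
    apply: (connect_trans (con' u h.1 _)); first by apply: val_inj; rewrite /= tu.
    apply: (connect_trans (connect1 jh)).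
    by apply: con'; apply: val_inj; rewrite /= tv.
  apply: (connect_trans (con' u h'.1 _)); first by apply: val_inj; rewrite /= tu.
  apply: (connect_trans (connect1 jh')).
  by apply: con'; apply: val_inj; rewrite /= tv.
- rewrite /acyclic.
  have -> : [set y | is_solid (att (join h h' g) y)] =
      h |: (h' |: [set y | is_solid (att g y)]).
    apply/setP => y; rewrite !inE ffunE; case: eqP => // _; by case: eqP.
  rewrite !cardsU1 !inE gh gh' /= (eq_sym h) (negPf h'h) /=.
  by move: ag; rewrite /acyclic !doubleS !addnS !addSn.
- have e : [set y | is_dotted (att g y)] =
      h |: (h' |: [set y | is_dotted (att (join h h' g) y)]).
    apply/setP => y; rewrite !inE ffunE; case: eqP => [->|_]; first by rewrite gh.
    by case: eqP => [->|_]; rewrite ?gh'.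
  move: dg; rewrite e !cardsU1 !inE !ffunE !eqxx (negPf h'h) (eq_sym h) (negPf h'h) /=.
  by rewrite doubleS; case.
Qed.

Section Beta.
Variables (k r n : nat).
Implicit Types G : hgraph k.+2 r.+1 n.

(* A dotted edge directed from the second tree to the first counts with a minus
   sign, as reversing it requires. *)
Definition beta_term (G : hgraph k.+2 r.+1 n) (h : hedge n) : C k.+1 r n :=
  if att G h is Dotted out h' then
    if (tree G h.1 == 0 :> nat) && (tree G h'.1 == 1 :> nat)
    then (-1) ^+ (~~ out) *: pclass r (join h h' G) else 0
  else 0.

Definition beta_graph G := \sum_h beta_term G h.

Definition beta_free : {freeg (hgraph k.+2 r.+1 n) / rat} -> C k.+1 r n :=
  flift beta_graph.
HB.instance Definition _ := GRing.Linear.on beta_free.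

Lemma relabelled_join f (g g' : pregraph n k.+2) h h' : injective f ->
  relabelled f g g' -> relabelled f (join h h' g) (join (f h) (f h') g').
Proof.
move=> fI gg' y; rewrite !ffunE !(inj_eq fI) gg'.
by case: ifP => // _; case: ifP.
Qed.

Lemma isomorphic_join f (g g' : pregraph n k.+2) h h' : injective f ->
  (forall h, f (next h) = next (f h)) -> relabelled f g g' ->
  (forall h, tree g' (f h).1 = tree g h.1) ->
  isomorphic (join h h' g) (join (f h) (f h') g').
Proof.
move=> fI fN gg' tf; exists f; split=> //; first exact: relabelled_join.
by move=> y; rewrite !ffunE tf.
Qed.

Lemma beta_relabel (e : rat) f G G' : injective f -> relabelled f G G' ->
  (forall h, tree G' (f h).1 = tree G h.1) ->
  (forall h h', hairy_lie r (join h h' G) ->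
     hairy_lie r (join (f h) (f h') G') ->
     pclass r (join h h' G) = e *: pclass r (join (f h) (f h') G')) ->
  beta_graph G = e *: beta_graph G'.
Proof.
move=> fI gg' tf ee; rewrite /beta_graph [in RHS](reindex_inj fI) scaler_sumr.
apply: eq_bigr => h _; rewrite /beta_term gg'.
case gh: (att G h) => [h'|b h'|x] /=; rewrite ?scaler0 // !tf.
case: ifP => [/andP[/eqP th /eqP th']|_]; last by rewrite scaler0.
rewrite ee 1?scalerA 1?mulrC -?scalerA //; apply: join_hairy (hgP _) _ _ _.
- exact: gh.
- by [].
- by [].
- by rewrite gg' gh.
- by rewrite tf.
- by rewrite tf.
Qed.

Lemma flip_vertex_inj v : injective (@flip_vertex n v).
Proof.
apply: inv_inj => -[u i]; rewrite /flip_vertex /=; case: (u =P v) => /= [->|/eqP uv].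
  by rewrite eqxx rev_ordK.
by rewrite (negPf uv).
Qed.

Lemma flip_vertex1 v (h : hedge n) : (flip_vertex v h).1 = h.1.
Proof. by rewrite /flip_vertex; case: ifP. Qed.

Lemma rotate3_inj (a b c : hedge n) :
  a != b -> a != c -> b != c -> injective (rotate3 a b c).
Proof.
move=> ab ac bc; have ba := ab; have ca := ac; have cb := bc.
move: ba ca cb; rewrite eq_sym => ba; rewrite eq_sym => ca; rewrite eq_sym => cb.
apply: (can_inj (g := rotate3 a c b)) => x; rewrite /rotate3.
case: (x =P a) => [->|/eqP xa]; first by rewrite eqxx (negPf ca).
case: (x =P b) => [->|/eqP xb]; first by rewrite eqxx.
case: (x =P c) => [->|/eqP xc]; first by rewrite (negPf ba) (negPf bc) eqxx.
by rewrite (negPf xa) (negPf xc) (negPf xb).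
Qed.

Lemma next_neq (h : hedge n) : next h != h.
Proof.
by case: h => v [[|[|[|i]]] iP]; rewrite /next xpair_eqE eqxx.
Qed.

Lemma rotate_ihx (h h' : hedge n) : h.1 != h'.1 ->
  injective (rotate3 (next h) (next (next h)) (next h')).
Proof.
move=> hh; apply: rotate3_inj; first by rewrite eq_sym next_neq.
  by apply: contraNneq hh => /(congr1 fst) /= ->.
by apply: contraNneq hh => /(congr1 fst) /= ->.
Qed.

Lemma rotate_ihx_tree (g : pregraph n k.+2) h h' y :
  tree g h'.1 = tree g h.1 ->
  tree g (rotate3 (next h) (next (next h)) (next h') y).1 = tree g y.1.
Proof.
rewrite /rotate3 => thh; case: eqP => [->|_]; first by rewrite /= thh.
by case: eqP => [->|_] //; case: eqP => [->|_] //=; rewrite thh.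
Qed.

Lemma beta_iso G G' : isomorphic G G' -> beta_graph G = beta_graph G'.
Proof.
case=> f [fI fN gg' tf]; rewrite -[RHS]scale1r; apply: (beta_relabel fI) => //.
move=> h h' gP g'P; rewrite scale1r; apply: pclass_iso => //.
exact: isomorphic_join.
Qed.

Lemma beta_as G G' v : relabelled (flip_vertex v) G G' -> tree G' = tree G ->
  beta_graph G = - beta_graph G'.
Proof.
move=> gg' tG; rewrite -scaleN1r; apply: (beta_relabel (@flip_vertex_inj v)) => //.
  by move=> h; rewrite flip_vertex1 tG.
move=> h h' gP g'P; rewrite scaleN1r; apply: (pclass_as (v := v)) => //.
  by apply: relabelled_join gg'; apply: flip_vertex_inj.
by apply/ffunP => u; rewrite !ffunE tG.
Qed.

Lemma beta_ihx G G' G'' h h' : att G h = Solid h' -> h.1 != h'.1 ->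
  let f := rotate3 (next h) (next (next h)) (next h') in
  relabelled f G G' -> tree G' = tree G ->
  relabelled f G' G'' -> tree G'' = tree G' ->
  beta_graph G + beta_graph G' + beta_graph G'' = 0.
Proof.
move=> gh hh f gg' tG' g'g'' tG''; have fI : injective f by apply: rotate_ihx.
have [/consistent_solid cG _ _ _] := hairyP _ _ (hgP G).
have [h'h gh' thh] := cG _ _ gh.
have tf y : tree G (f y).1 = tree G y.1 by apply: rotate_ihx_tree.
rewrite /beta_graph [X in _ + X + _](reindex_inj fI).
rewrite [X in _ + X](reindex_inj (inj_comp fI fI)) -!big_split /=.
apply: big1 => y _; rewrite /beta_term g'g'' gg' tG'' tG'.
case gy: (att G y) => [y'|b y'|x] /=; rewrite ?addr0 // !tf.
case: ifP => [/andP[/eqP ty /eqP ty']|_]; last by rewrite ?addr0.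
have [yh yh'] : y != h /\ y' != h.
  split; apply/eqP => e; first by rewrite e gh in gy.
  have [/consistent_dotted cG' _ _ _] := hairyP _ _ (hgP G).
  by have [] := cG' _ _ _ gy; rewrite e gh.
rewrite -!scalerDr; apply/eqP; rewrite scaler_eq0; apply/orP; right; apply/eqP.
apply: (pclass_ihx (h := h) (h' := h')) => //.
- exact: join_hairy (hgP G) gy ty ty'.
- by apply: (join_hairy (b := b) (hgP G')); rewrite ?gg' ?gy // tG' tf.
- by apply: (join_hairy (b := b) (hgP G'')); rewrite ?g'g'' ?gg' ?gy // tG'' tG' !tf.
- by rewrite ffunE (eq_sym h) (negPf yh) (eq_sym h) (negPf yh').
- exact: relabelled_join.
- by apply/ffunP => u; rewrite !ffunE tG'.
- exact: relabelled_join.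
- by apply/ffunP => u; rewrite !ffunE tG'' tG'.
Qed.

Lemma beta_multilinear G G' G'' h a x y : att G h = Hair n (a *: x + y) ->
  hg G' = set_hair h x G -> hg G'' = set_hair h y G ->
  beta_graph G = a *: beta_graph G' + beta_graph G''.
Proof.
move=> gh eG' eG''; rewrite /beta_graph scaler_sumr -big_split /=.
apply: eq_bigr => z _.
have aa (w : H) (K : hgraph k.+2 r.+1 n) : hg K = set_hair h w G ->
    beta_term K z = if att G z is Dotted b z' then
      if (tree G z.1 == 0 :> nat) && (tree G z'.1 == 1 :> nat)
      then (-1) ^+ (~~ b) *: pclass r (join z z' K) else 0 else 0.
  move=> eK; rewrite /beta_term {1}eK ffunE; have [->|_] := eqVneq z h.
    by rewrite gh.
  by case: (att G z) => // b z'; rewrite eK.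
rewrite (aa x G') // (aa y G'') // /beta_term.
case gz: (att G z) => [z'|b z'|w]; rewrite ?scaler0 ?addr0 //.
case: ifP => [/andP[/eqP tz /eqP tz']|_]; last by rewrite ?scaler0 ?addr0.
have zh : h != z by apply/eqP => e; rewrite e gz in gh.
have [/consistent_dotted cG' _ _ _] := hairyP _ _ (hgP G).
have [gz' zz'] := cG' _ _ _ gz.
have z'h : h != z' by apply/eqP => e; rewrite e gz' in gh.
rewrite scalerA mulrC -scalerA -scalerDr; congr (_ *: _).
have jw w : join z z' (set_hair h w G) = set_hair h w (join z z' G).
  congr Pregraph; apply/ffunP => u; rewrite !ffunE.
  have [->|uz] := eqVneq u z; first by rewrite eq_sym (negPf zh).
  by have [->|//] := eqVneq u z'; rewrite eq_sym (negPf z'h).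
have ok (w : H) (K : hgraph k.+2 r.+1 n) : hg K = set_hair h w G ->
    hairy_lie r (join z z' K).
  move=> eK; apply: (join_hairy (b := b) (hgP K)); rewrite eK //.
  by rewrite ffunE eq_sym (negPf zh).
apply: (pclass_multilinear (h := h) (x := x) (y := y)).
- exact: join_hairy (hgP G) gz tz tz'.
- exact: ok eG'.
- exact: ok eG''.
- by rewrite ffunE (negPf zh) (negPf z'h).
- by rewrite eG' jw.
- by rewrite eG'' jw.
Qed.

Lemma beta_direction G G' h b h' : att G h = Dotted b h' ->
  hg G' = reverse_edge h h' G -> beta_graph G = - beta_graph G'.
Proof.
move=> gh eG'; rewrite /beta_graph -sumrN; apply: eq_bigr => z _.
have [/consistent_dotted cG' _ _ _] := hairyP _ _ (hgP G).
have [gh' hh'] := cG' _ _ _ gh.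
have gz' : att G' z = if (z == h) || (z == h') then port_rev (att G z) else att G z.
  by rewrite eG' ffunE.
rewrite /beta_term gz' eG' /=; clear gz'.
have [zh|zh] := boolP ((z == h) || (z == h')).
  have [c [z' [gz zz']]] : exists c (z' : hedge n), att G z = Dotted c z' /\
      ((z = h /\ z' = h') \/ (z = h' /\ z' = h)).
    case/orP: zh => /eqP->; first by exists b, h'; split=> //; left.
    by exists (~~ b), h; split=> //; right.
  rewrite gz /=; case: ifP => _; last by rewrite oppr0.
  have -> : join z z' (reverse_edge h h' G) = join z z' G.
    congr Pregraph; apply/ffunP => u; rewrite !ffunE.
    have [//|uz] := eqVneq u z; have [//|uz'] := eqVneq u z'.
    by case: zz' uz uz' => -[-> ->] /negPf-> /negPf->.
  by case: c {gz}; rewrite /= ?expr0 ?expr1 ?scaleN1r ?scale1r ?opprK.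
case gz: (att G z) => [z'|c z'|w]; rewrite ?oppr0 //.
case: ifP => [/andP[/eqP tz /eqP tz']|_]; last by rewrite oppr0.
rewrite -scalerN; congr (_ *: _).
have [gz' zz'] := cG' _ _ _ gz.
move: zh; rewrite negb_or => /andP[zh zh'].
have z'h : z' != h.
  by apply: contraNneq zh' => e; move: gz'; rewrite e gh => -[_ ->].
have z'h' : z' != h'.
  by apply: contraNneq zh => e; move: gz'; rewrite e gh' => -[_ ->].
apply: (pclass_direction (h := h) (b := b) (h' := h')).
- exact: join_hairy (hgP G) gz tz tz'.
- rewrite -eG'; apply: (join_hairy (b := c) (hgP G')); rewrite eG' //.
  by rewrite ffunE (negPf zh) (negPf zh').
- by rewrite ffunE eq_sym (negPf zh) eq_sym (negPf z'h).
- congr Pregraph; apply/ffunP => u; rewrite !ffunE.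
  have [->|uz] := eqVneq u z; first by rewrite (negPf zh) (negPf zh').
  by have [->|//] := eqVneq u z'; rewrite (negPf z'h) (negPf z'h').
Qed.

Lemma beta_graph_relation D : graph_relation D -> beta_free D = 0.
Proof.
have bU G : beta_free << G >> = beta_graph G by rewrite /beta_free fliftU.
case.
- by move=> G G' /beta_iso e; rewrite raddfB /= !bU e subrr.
- by move=> G G' v gg' tg; rewrite raddfD /= !bU (beta_as gg' tg) addNr.
- move=> G G' G'' h h' gh hh f *; rewrite !raddfD /= !bU.
  exact: (beta_ihx gh hh).
- move=> G G' G'' h a x y gh eG' eG''; rewrite !raddfB /= linearZ /= !bU.
  by rewrite (beta_multilinear gh eG' eG'') -addrA -opprD subrr.
- by move=> G G' h b h' gh eG'; rewrite raddfD /= !bU (beta_direction gh eG') addNr.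
Qed.

Definition beta : C k.+2 r.+1 n -> C k.+1 r n := qlift beta_graph_relation.
HB.instance Definition _ := GRing.Linear.on beta.

Lemma betaE G : beta (gclass G) = beta_graph G.
Proof. by rewrite /beta qliftE /= /beta_free fliftU. Qed.

End Beta.

Section Trace.
Variables (r n : nat) (omega : {skew_symmetric H}).
Notation hpair := (hedge n * hedge n)%type.
Implicit Types (g : pregraph n 1) (M : {set hpair}) (p q : hpair).

Definition color g (h : hedge n) : H := if att g h is Hair x then x else 0.

(* A set of r pairwise disjoint pairs of leaves. *)
Definition pairing g M :=
  [&& #|M| == r,
      [forall p in M, [&& is_hair (att g p.1), is_hair (att g p.2) & p.1 != p.2]]
    & [forall p in M, forall q in M, (p != q) ==>
        [disjoint [set p.1; p.2] & [set q.1; q.2]]]].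

(* The representative (l1, l2) of the unordered pair {l1, l2} that is chosen in
   the trace; by skew-symmetry the result does not depend on this choice. *)
Definition increasing p := (enum_rank p.1 < enum_rank p.2)%N.

Definition mate M (x : hedge n) : option (bool * hedge n) :=
  if [pick y | (x, y) \in M] is Some y then Some (true, y)
  else if [pick y | (y, x) \in M] is Some y then Some (false, y) else None.

Definition add_dotted M g := Pregraph
  [ffun x => if mate M x is Some (out, y) then Dotted out y else att g x]
  (tree g).

Definition trace_term g M : C 1 r n :=
  (\prod_(p in M) omega (color g p.1) (color g p.2)) *: pclass r (add_dotted M g).

Definition trace_graph (G : hgraph 1 0 n) : C 1 r n :=
  \sum_(M | pairing G M && [forall p in M, increasing p]) trace_term G M.

Definition trace_free : {freeg (hgraph 1 0 n) / rat} -> C 1 r n :=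
  flift trace_graph.
HB.instance Definition _ := GRing.Linear.on trace_free.

Lemma pairing_leaf g M p : pairing g M -> p \in M ->
  [/\ is_hair (att g p.1), is_hair (att g p.2) & p.1 != p.2].
Proof. by case/and3P => _ /forall_inP h _ /h/and3P. Qed.

Lemma pairing_eq g M p q x : pairing g M -> p \in M -> q \in M ->
  (x == p.1) || (x == p.2) -> (x == q.1) || (x == q.2) -> p = q.
Proof.
case/and3P => _ _ /forall_inP d /d/forall_inP{}d /d/implyP{}d xp xq.
apply/eqP/negPn/negP => /d; rewrite disjoint_subset => /subsetP/(_ x).
by rewrite !inE xp xq => /(_ isT).
Qed.

Lemma pairing_fst g M x y z : pairing g M -> (x, y) \in M -> (x, z) \in M -> y = z.
Proof.
move=> gM xy xz; have := pairing_eq (x := x) gM xy xz.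
by rewrite /= !eqxx => /(_ isT isT) [].
Qed.

Lemma pairing_snd g M x y z : pairing g M -> (y, x) \in M -> (z, x) \in M -> y = z.
Proof.
move=> gM xy xz; have := pairing_eq (x := x) gM xy xz.
by rewrite /= !eqxx !orbT => /(_ isT isT) [].
Qed.

Lemma pairing_mixed g M x y z : pairing g M -> (x, y) \in M -> (z, x) \in M -> False.
Proof.
move=> gM xy zx; have := pairing_eq (x := x) gM xy zx.
rewrite /= !eqxx !orbT => /(_ isT isT) [xz yx].
by have [_ _] := pairing_leaf gM xy; rewrite /= yx eqxx.
Qed.

Lemma mateP g M x b y : pairing g M ->
  reflect (mate M x = Some (b, y)) ((if b then (x, y) else (y, x)) \in M).
Proof.
move=> gM; rewrite /mate; case: pickP => [z xz|xN].
  case: b; apply: (iffP idP) => [xy|[]] //; try by move=> <-.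
    by rewrite (pairing_fst gM xz xy).
  by case: (pairing_mixed gM xz xy).
case: pickP => [z zx|Nx]; case: b; rewrite ?xN ?Nx.
- by constructor.
- by apply: (iffP idP) => [yx|[<-] //]; rewrite (pairing_snd gM zx yx).
- by constructor.
- by constructor.
Qed.

Lemma mate_sym g M x b y : pairing g M -> mate M x = Some (b, y) ->
  mate M y = Some (~~ b, x).
Proof.
by move=> gM /(mateP _ _ _ gM) xy; apply/(mateP _ _ _ gM); case: b xy.
Qed.

Lemma mate_hair g M x b y : pairing g M -> mate M x = Some (b, y) ->
  is_hair (att g x).
Proof.
move=> gM /(mateP _ _ _ gM) xy; have [] := pairing_leaf gM xy.
by case: b {xy}.
Qed.

Lemma add_dotted_hairy g M : hairy_lie 0 g -> pairing g M ->
  hairy_lie r (add_dotted M g).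
Proof.
move=> /hairyP[cg con ag dg] gM.
have solid y : is_solid (att (add_dotted M g) y) = is_solid (att g y).
  rewrite ffunE; case E: (mate M y) => [[b z]|] //=.
  by move: (mate_hair gM E); case: (att g y).
have adj : adjacent (add_dotted M g) =2 adjacent g.
  move=> u v; apply: eq_existsb => i; apply: eq_existsb => j; rewrite ffunE.
  case E: (mate M (u, i)) => [[b z]|] //=.
  by move: (mate_hair gM E); case: (att g (u, i)).
apply/hairyP; split.
- apply/forallP => y; rewrite ffunE; case E: (mate M y) => [[b z]|].
    by rewrite ffunE (mate_sym gM E).
  case gy: (att g y) => [z|b z|x] //.
    have [zy gz ->] := consistent_solid cg gy; rewrite zy eqxx andbT ffunE.
    case E': (mate M z) => [[b w]|]; last by rewrite gz eqxx.
    by move: (mate_hair gM E'); rewrite gz.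
  by move/eqP: dg; rewrite cards_eq0 => /eqP/setP/(_ y); rewrite !inE gy.
- case/andP: con => ne /forallP con; apply/andP; split=> //.
  apply/forallP => u; apply/forallP => v; apply/implyP => tuv.
  by rewrite (eq_connect adj); have /forallP/(_ v)/implyP/(_ tuv) := con u.
- rewrite /acyclic; move: ag; rewrite /acyclic; congr (_ + _ == _)%N.
  by apply: eq_card => y; rewrite !inE solid.
- have -> : [set y | is_dotted (att (add_dotted M g) y)] =
      (@fst _ _ @: M) :|: (@snd _ _ @: M).
    apply/setP => y; rewrite !inE ffunE; case E: (mate M y) => [[[] z]|] /=.
    + symmetry; apply/orP; left; apply/imsetP; exists (y, z) => //.
      exact/(mateP y true z gM).
    + symmetry; apply/orP; right; apply/imsetP; exists (z, y) => //.
      exact/(mateP y false z gM).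
    + have -> : is_dotted (att g y) = false.
        by move/eqP: dg; rewrite cards_eq0 => /eqP/setP/(_ y); rewrite !inE.
      symmetry; apply/negP => /orP[] /imsetP[[z w] zw /= yz].
        by have /(mateP y true w gM) : (y, w) \in M by [rewrite yz]; rewrite E.
      by have /(mateP y false z gM) : (z, y) \in M by [rewrite yz]; rewrite E.
  have fM : #|(@fst _ _ @: M)| = r.
    rewrite card_in_imset; first by case/and3P: gM => /eqP.
    by move=> p q pM qM pq; apply: (pairing_eq (x := p.1) gM) => //;
      rewrite ?eqxx // pq eqxx.
  have sM : #|(@snd _ _ @: M)| = r.
    rewrite card_in_imset; first by case/and3P: gM => /eqP.
    by move=> p q pM qM pq; apply: (pairing_eq (x := p.2) gM) => //;
      rewrite ?eqxx ?orbT // pq eqxx orbT.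
  rewrite cardsU fM sM.
  suff -> : (@fst _ _ @: M) :&: (@snd _ _ @: M) = set0.
    by rewrite cards0 subn0 addnn.
  apply/eqP; rewrite -subset0; apply/subsetP => y; rewrite inE.
  case/andP => /imsetP[p pM yp] /imsetP[q qM yq].
  have pq : p = q by apply: (pairing_eq (x := y) gM) => //; rewrite ?yp ?eqxx // -yp yq eqxx orbT.
  by have [_ _] := pairing_leaf gM pM; rewrite -yp yq pq eqxx.
Qed.

Definition swap p : hpair := (p.2, p.1).
Definition swap_in p M := swap p |: M :\ p.

Lemma swapK : involutive swap. Proof. by case. Qed.

Lemma swap_notin g M p : pairing g M -> p \in M -> swap p \notin M.
Proof.
move=> gM pM; apply/negP => sM.
have e : p = swap p by apply: (pairing_eq (x := p.1) gM) => //; rewrite eqxx ?orbT.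
by have [_ _] := pairing_leaf gM pM; rewrite {1}e eqxx.
Qed.

Lemma swap_pairing g M p : pairing g M -> p \in M -> pairing g (swap_in p M).
Proof.
move=> gM pM; have [h1 h2 p12] := pairing_leaf gM pM.
have rep q : q \in swap_in p M -> exists2 q', q' \in M &
    (forall x, (x == q.1) || (x == q.2) = (x == q'.1) || (x == q'.2)) /\
    (q = if q' == p then swap p else q').
  rewrite !inE => /orP[/eqP->|/andP[qp qM]].
    by exists p => //; split; [move=> x; rewrite orbC|rewrite eqxx].
  by exists q => //; split=> //; rewrite (negPf qp).
apply/and3P; split.
- rewrite cardsU1 !inE negb_and (swap_notin gM pM) orbT add1n.
  by have := cardsD1 p M; rewrite pM add1n => <-; case/and3P: gM.
- apply/forall_inP => q /rep[q' q'M [_ ->]]; case: eqP => [_|_].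
    by rewrite /= h1 h2 eq_sym p12.
  by apply/and3P; have [] := pairing_leaf gM q'M.
- apply/forall_inP => q1 /rep[q1' M1 [s1 e1]].
  apply/forall_inP => q2 /rep[q2' M2 [s2 e2]].
  apply/implyP => q12; rewrite disjoint_subset; apply/subsetP => x.
  rewrite !inE s1 s2 => x1; apply/negP => x2; case/eqP: q12.
  by rewrite e1 e2 (pairing_eq gM M1 M2 x1 x2).
Qed.

Lemma skewC x y : omega x y = - omega y x.
Proof. by rewrite hermC expr1 mulN1r. Qed.

Lemma add_dotted_swap g M p : pairing g M -> p \in M ->
  add_dotted (swap_in p M) g = reverse_edge p.1 p.2 (add_dotted M g).
Proof.
move=> gM pM; have gM' := swap_pairing gM pM.
have sM := swap_notin gM pM; have [_ _ p12] := pairing_leaf gM pM.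
congr Pregraph; apply/ffunP => x; rewrite !ffunE.
have [->|xp1] := eqVneq x p.1.
  have /(mateP p.1 true p.2 gM)-> : (p.1, p.2) \in M by rewrite -surjective_pairing.
  have /(mateP p.1 false p.2 gM')-> // : (p.2, p.1) \in swap_in p M.
  by rewrite !inE eqxx.
have [->|xp2] := eqVneq x p.2.
  have /(mateP p.2 false p.1 gM)-> : (p.1, p.2) \in M by rewrite -surjective_pairing.
  have /(mateP p.2 true p.1 gM')-> // : (p.2, p.1) \in swap_in p M.
  by rewrite !inE eqxx.
rewrite /=; suff -> : mate (swap_in p M) x = mate M x by [].
have ne (b : bool) y : (if b then (x, y) else (y, x)) != p /\
    (if b then (x, y) else (y, x)) != swap p.
  by split; apply/eqP => e; move: xp1 xp2; rewrite -(swapK p) -?e;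
    move: e; case: b => /= e; rewrite ?[in X in X -> _]e; case: p e {pM gM' sM p12} => p1 p2 [] -> ->;
    rewrite /= ?eqxx.
have mm b y : mate (swap_in p M) x = Some (b, y) <-> mate M x = Some (b, y).
  have [n1 n2] := ne b y.
  split=> [/(mateP _ _ _ gM')|/(mateP _ _ _ gM)] xy.
    by apply/(mateP _ _ _ gM); move: xy; rewrite !inE (negPf n1) (negPf n2).
  by apply/(mateP _ _ _ gM'); rewrite !inE n1 xy orbT.
case E: (mate (swap_in p M) x) => [[b y]|]; first by symmetry; apply/mm.
by case E': (mate M x) => [[b y]|] //; move/mm: E'; rewrite E.
Qed.

Lemma trace_term_swap g M p : hairy_lie 0 g -> pairing g M -> p \in M ->
  trace_term g (swap_in p M) = trace_term g M.
Proof.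
move=> gP gM pM; rewrite /trace_term; have gM' := swap_pairing gM pM.
rewrite (bigD1 (swap p)) /=; last by rewrite !inE eqxx.
rewrite [in RHS](bigD1 p) //= skewC mulNr scaleNr -scalerN; congr (_ *: _).
  congr (_ * _); apply: eq_bigl => q; rewrite !inE.
  have [->|qs] := eqVneq q (swap p); last by rewrite andbT andbC.
  by rewrite (negPf (swap_notin gM pM)) andbF.
have /(mateP p.1 true p.2 gM) m12 : (p.1, p.2) \in M by rewrite -surjective_pairing.
rewrite (pclass_direction (h := p.1) (b := true) (h' := p.2)
  (add_dotted_hairy gP gM) (add_dotted_hairy gP gM') _ (add_dotted_swap gM pM)) ?opprK //.
by rewrite ffunE m12.
Qed.

Definition normal p := if increasing p then p else swap p.

Lemma normal_swap p : p.1 != p.2 -> normal (swap p) = normal p.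
Proof.
move=> p12; rewrite /normal /increasing /=; case: ltngtP => e; rewrite ?swapK //.
by case/eqP: p12; apply/enum_rank_inj/val_inj.
Qed.

Lemma normal_increasing p : p.1 != p.2 -> increasing (normal p).
Proof.
move=> p12; rewrite /normal /increasing; case: ifP => // /negbT.
rewrite -leqNgt leq_eqVlt => /orP[/eqP e|//].
by case/eqP: p12; apply/enum_rank_inj/val_inj.
Qed.

Lemma trace_normal g M : hairy_lie 0 g -> pairing g M ->
  pairing g (normal @: M) /\ trace_term g (normal @: M) = trace_term g M.
Proof.
move=> gP; have [m] := ubnP #|[set p in M | ~~ increasing p]|.
elim: m M => // m IH M lem gM.
have [E|[p]] := set_0Vmem [set p in M | ~~ increasing p].
  have -> // : normal @: M = M.
  have id_on : {in M, normal =1 id}.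
    move=> p pM; rewrite /normal; case: ifP => // /negbT ip.
    by move/setP/(_ p): E; rewrite !inE pM ip.
  by rewrite (eq_in_imset id_on) imset_id.
rewrite inE => /andP[pM ip]; have gM' := swap_pairing gM pM.
have [_ _ p12] := pairing_leaf gM pM.
have e : normal @: swap_in p M = normal @: M.
  rewrite imsetU1 normal_swap // -imsetU1; congr (_ @: _).
  by rewrite setD1K.
rewrite -e -(trace_term_swap gP gM pM); apply: IH => //.
rewrite -ltnS; apply: leq_trans lem; rewrite ltnS; apply: proper_card.
have pN : p != swap p by apply: contraNneq p12 => pe; rewrite {1}pe eqxx.
apply/properP; split; last first.
  by exists p; rewrite !inE ?pM ?ip // (negPf pN) eqxx.
apply/subsetP => q; rewrite !inE => /andP[/orP[/eqP->|/andP[_ ->]] //].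
have := normal_increasing p12; rewrite /normal (negPf ip) => ->.
by [].
Qed.

Definition pair_map (f : hedge n -> hedge n) p : hpair := (f p.1, f p.2).

Lemma pair_map_inj f : injective f -> injective (pair_map f).
Proof. by move=> fI [a b] [c d] [/fI-> /fI->]. Qed.

Lemma pairing_map f g g' M : injective f -> relabelled f g g' ->
  pairing g M -> pairing g' (pair_map f @: M).
Proof.
move=> fI gg' gM; apply/and3P; split.
- by rewrite card_imset; [case/and3P: gM|apply: pair_map_inj].
- apply/forall_inP => _ /imsetP[p pM ->]; have [h1 h2 p12] := pairing_leaf gM pM.
  rewrite /= !gg' (inj_eq fI) p12 andbT.
  by case: (att g p.1) h1; case: (att g p.2) h2.
- apply/forall_inP => _ /imsetP[p pM ->]; apply/forall_inP => _ /imsetP[q qM ->].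
  apply/implyP => pq; rewrite disjoint_subset; apply/subsetP => x.
  rewrite !inE /= => xp; apply/negP => xq; case/eqP: pq.
  have [y xy] : exists y, x = f y by case/orP: xp => /eqP->; eexists.
  move: xp xq; rewrite xy !(inj_eq fI) => xp xq.
  by rewrite (pairing_eq gM pM qM xp xq).
Qed.

Lemma add_dotted_map f g g' M : injective f -> relabelled f g g' ->
  pairing g M -> relabelled f (add_dotted M g) (add_dotted (pair_map f @: M) g').
Proof.
move=> fI gg' gM x; have gM' := pairing_map fI gg' gM; rewrite !ffunE.
case E: (mate M x) => [[b y]|].
  have /(mateP _ _ _ gM')-> // : (if b then (f x, f y) else (f y, f x)) \in pair_map f @: M.
  move/(mateP _ _ _ gM): E; case: b => xy; apply/imsetP.
    by exists (x, y).
  by exists (y, x).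
case E': (mate _ _) => [[b y]|]; last exact: gg'.
move/(mateP _ _ _ gM'): E'; case: b => /imsetP[[z w] zw [e1 e2]].
  move: e1 => /fI e1.
  by have /(mateP x true w gM) : (x, w) \in M by [rewrite e1]; rewrite E.
move: e2 => /fI e2.
by have /(mateP x false z gM) : (z, x) \in M by [rewrite e2]; rewrite E.
Qed.

Lemma color_map f g g' h : relabelled f g g' -> color g' (f h) = color g h.
Proof. by move=> gg'; rewrite /color gg'; case: (att g h). Qed.

Definition increasing_map f M := normal @: (pair_map f @: M).

Definition selected g M := pairing g M && [forall p in M, increasing p].

Lemma selected_map f g g' M : injective f -> relabelled f g g' ->
  hairy_lie 0 g' -> selected g M -> selected g' (increasing_map f M).
Proof.
move=> fI gg' g'P /andP[gM _]; have gM' := pairing_map fI gg' gM.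
apply/andP; split; first by have [] := trace_normal g'P gM'.
apply/forall_inP => _ /imsetP[p pM ->].
by have [_ _] := pairing_leaf gM' pM; apply: normal_increasing.
Qed.

Lemma increasing_mapK f f' g M : cancel f f' -> cancel f' f ->
  selected g M -> increasing_map f' (increasing_map f M) = M.
Proof.
move=> fK f'K /andP[gM /forall_inP oM]; rewrite /increasing_map -!imset_comp.
have e : {in M, normal \o (pair_map f' \o (normal \o pair_map f)) =1 id}.
  move=> p pM; rewrite /= {2}/normal; have oq := oM _ pM.
  have [_ _ p12] := pairing_leaf gM pM.
  have np : normal p = p by rewrite /normal oq.
  case: ifP => _; rewrite /pair_map /= !fK.
    by rewrite -surjective_pairing.
  by rewrite -/(swap p) normal_swap.
by rewrite (eq_in_imset e) imset_id.
Qed.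

Lemma trace_reindex f (G G' : hgraph 1 0 n) : injective f -> relabelled f G G' ->
  trace_graph G' = \sum_(M | selected G M)
    (\prod_(p in M) omega (color G p.1) (color G p.2))
      *: pclass r (add_dotted (pair_map f @: M) G').
Proof.
move=> fI gg'; pose f' := invF fI.
have fK : cancel f f' by apply: invF_f.
have f'K : cancel f' f by apply: f_invF.
have f'I : injective f' by apply: can_inj f'K.
have g'g : relabelled f' G' G.
  move=> x; rewrite -{2}[x]f'K gg'; case: (att G (f' x)) => //= [y|b y].
    by rewrite fK.
  by rewrite fK.
rewrite /trace_graph.
rewrite (reindex_onto (increasing_map f) (increasing_map f')) /=; last first.
  by move=> M; apply: increasing_mapK.
rewrite (eq_bigl (selected G)); last first.
  move=> M; apply/andP/idP => [[sM' /eqP<-]|sM].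
    exact: (selected_map f'I g'g (hgP G) sM').
  split; last by rewrite (increasing_mapK fK f'K sM).
  exact: (selected_map fI gg' (hgP G') sM).
apply: eq_bigr => M /andP[gM _].
have [_ ->] := trace_normal (hgP G') (pairing_map fI gg' gM).
rewrite /trace_term big_imset /=; last by move=> ? ? _ _; apply: pair_map_inj.
by congr (_ *: _); apply: eq_bigr => p _; rewrite !(color_map _ gg').
Qed.

Lemma trace_relabel (e : rat) f (G G' : hgraph 1 0 n) :
  injective f -> relabelled f G G' ->
  (forall g g' : pregraph n 1, hairy_lie r g -> hairy_lie r g' ->
     relabelled f g g' -> tree g = tree G -> tree g' = tree G' ->
     pclass r g = e *: pclass r g') ->
  trace_graph G = e *: trace_graph G'.
Proof.
move=> fI gg' ee; rewrite (trace_reindex fI gg') scaler_sumr.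
apply: eq_bigr => M /andP[gM _]; rewrite scalerA mulrC -scalerA; congr (_ *: _).
apply: ee => //; last exact: add_dotted_map.
  exact: add_dotted_hairy (hgP G) gM.
exact: add_dotted_hairy (hgP G') (pairing_map fI gg' gM).
Qed.

Lemma trace_iso G G' : isomorphic (hg G) (hg G') -> trace_graph G = trace_graph G'.
Proof.
case=> f [fI fN gg' tf]; rewrite -[RHS]scale1r; apply: (trace_relabel fI gg').
move=> g g' gP g'P rgg' tg tg'; rewrite scale1r; apply: pclass_iso => //.
by exists f; split=> // h; rewrite tg tg'.
Qed.

Lemma trace_as G G' v : relabelled (flip_vertex v) (hg G) (hg G') ->
  tree G' = tree G -> trace_graph G = - trace_graph G'.
Proof.
move=> gg' tG; rewrite -scaleN1r.
apply: (trace_relabel (@flip_vertex_inj n v) gg').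
move=> g g' gP g'P rgg' tg tg'; rewrite scaleN1r.
by apply: (pclass_as (v := v)) => //; rewrite tg tg'.
Qed.
Lemma trace_ihx (G G' G'' : hgraph 1 0 n) h h' :
  att G h = Solid h' -> h.1 != h'.1 ->
  let f := rotate3 (next h) (next (next h)) (next h') in
  relabelled f G G' -> tree G' = tree G ->
  relabelled f G' G'' -> tree G'' = tree G' ->
  trace_graph G + trace_graph G' + trace_graph G'' = 0.
Proof.
move=> gh hh f gg' tG' g'g'' tG''; have fI : injective f by apply: rotate_ihx.
have gg'' : relabelled (f \o f) G G''.
  by move=> x; rewrite /= g'g'' gg'; case: (att G x).
rewrite (trace_reindex fI gg') (trace_reindex (inj_comp fI fI) gg'').
rewrite -!big_split /=; apply: big1 => M /andP[gM _].
have gM' := pairing_map fI gg' gM.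
have e : pair_map (f \o f) @: M = pair_map f @: (pair_map f @: M).
  by rewrite -imset_comp.
rewrite -!scalerDr e; apply/eqP; rewrite scaler_eq0; apply/orP; right; apply/eqP.
apply: (pclass_ihx (h := h) (h' := h')) => //.
- exact: add_dotted_hairy (hgP G) gM.
- exact: add_dotted_hairy (hgP G') gM'.
- exact: add_dotted_hairy (hgP G'') (pairing_map fI g'g'' gM').
- rewrite ffunE gh; case E: (mate M h) => [[b y]|] //.
  by move: (mate_hair gM E); rewrite gh.
- exact: add_dotted_map.
- exact: add_dotted_map.
Qed.

Lemma pairing_set_hair g M h x : is_hair (att g h) ->
  pairing (set_hair h x g) M = pairing g M.
Proof.
move=> gh; have hh y : is_hair (att (set_hair h x g) y) = is_hair (att g y).
  by rewrite ffunE; case: eqP => [->|].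
by rewrite /pairing; congr [&& _, _ & _]; apply: eq_forallb => p; rewrite !hh.
Qed.

Lemma color_set_hair g h x y :
  color (set_hair h x g) y = if y == h then x else color g y.
Proof. by rewrite /color ffunE; case: ifP. Qed.

Lemma trace_multilinear (G G' G'' : hgraph 1 0 n) h a x y :
  att G h = Hair n (a *: x + y) ->
  hg G' = set_hair h x G -> hg G'' = set_hair h y G ->
  trace_graph G = a *: trace_graph G' + trace_graph G''.
Proof.
move=> gh eG' eG''; rewrite /trace_graph scaler_sumr.
have ghair : is_hair (att G h) by rewrite gh.
under [in RHS]eq_bigl => M do rewrite eG' pairing_set_hair //.
under [X in _ + X]eq_bigl => M do rewrite eG'' pairing_set_hair //.
rewrite -big_split /=; apply: eq_bigr => M /andP[gM _]; rewrite /trace_term.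
have cG : color G h = a *: x + y by rewrite /color gh.
have [/existsP[p /andP[pM hp]]|Nh] :=
  boolP [exists p in M, (h == p.1) || (h == p.2)].
  have same w : add_dotted M (set_hair h w G) = add_dotted M G.
    congr Pregraph; apply/ffunP => u; rewrite !ffunE.
    have [->|//] := eqVneq u h.
    case/orP: hp => /eqP hp.
      by have /(mateP h true p.2 gM)-> : (h, p.2) \in M by rewrite hp -surjective_pairing.
    by have /(mateP h false p.1 gM)-> : (p.1, h) \in M by rewrite hp -surjective_pairing.
  rewrite eG' eG'' !same scalerA -scalerDl; congr (_ *: _).
  have rest w : \prod_(q in M | q != p)
        omega (color (set_hair h w G) q.1) (color (set_hair h w G) q.2) =
      \prod_(q in M | q != p) omega (color G q.1) (color G q.2).
    apply: eq_bigr => q /andP[qM qp]; rewrite !color_set_hair.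
    have : ~~ ((h == q.1) || (h == q.2)).
      by apply: contraNN qp => hq; rewrite (pairing_eq gM qM pM hq hp).
    by rewrite negb_or ![h == _]eq_sym => /andP[/negPf-> /negPf->].
  rewrite !(bigD1 p pM) /= !rest mulrA -mulrDl; congr (_ * _).
  rewrite !color_set_hair; have [_ _ p12] := pairing_leaf gM pM.
  case/orP: hp => /eqP hp; rewrite -hp in p12 *; rewrite eqxx.
    by rewrite eq_sym (negPf p12) cG linearPl.
  by rewrite (negPf p12) cG linearPr.
have Nhp p : p \in M -> (p.1 == h = false) * (p.2 == h = false).
  move=> pM; move: Nh; rewrite negb_exists => /forallP/(_ p); rewrite pM negb_or.
  by rewrite ![h == _]eq_sym => /andP[/negPf-> /negPf->].
have mh : mate M h = None.
  case E: (mate M h) => [[b z]|] //; move/(mateP _ _ _ gM): E.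
  by case: b => /Nhp[]; rewrite /= eqxx.
have prodE w : \prod_(q in M)
      omega (color (set_hair h w G) q.1) (color (set_hair h w G) q.2) =
    \prod_(q in M) omega (color G q.1) (color G q.2).
  by apply: eq_bigr => q /Nhp[e1 e2]; rewrite !color_set_hair e1 e2.
have add_set w : add_dotted M (set_hair h w G) = set_hair h w (add_dotted M G).
  congr Pregraph; apply/ffunP => u; rewrite !ffunE.
  by have [->|//] := eqVneq u h; rewrite mh.
rewrite eG' eG'' !prodE scalerA mulrC -scalerA -scalerDr; congr (_ *: _).
apply: (pclass_multilinear (h := h) (x := x) (y := y)).
- exact: add_dotted_hairy (hgP G) gM.
- by apply: add_dotted_hairy; rewrite -?eG' ?(hgP G') // eG' pairing_set_hair.
- by apply: add_dotted_hairy; rewrite -?eG'' ?(hgP G'') // eG'' pairing_set_hair.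
- by rewrite ffunE mh.
- exact: add_set.
- exact: add_set.
Qed.

Lemma trace_graph_relation D : graph_relation D -> trace_free D = 0.
Proof.
have tU G : trace_free << G >> = trace_graph G by rewrite /trace_free fliftU.
case.
- by move=> G G' /trace_iso e; rewrite raddfB /= !tU e subrr.
- by move=> G G' v gg' tg; rewrite raddfD /= !tU (trace_as gg' tg) addNr.
- move=> G G' G'' h h' gh hh f *; rewrite !raddfD /= !tU.
  exact: (trace_ihx gh hh).
- move=> G G' G'' h a x y gh eG' eG''; rewrite !raddfB /= linearZ /= !tU.
  by rewrite (trace_multilinear gh eG' eG'') -addrA -opprD subrr.
- move=> G G' h b h' gh eG'; have [_ _ _ /eqP] := hairyP _ _ (hgP G).
  by rewrite cards_eq0 => /eqP/setP/(_ h); rewrite !inE gh.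
Qed.

Definition trace : C 1 0 n -> C 1 r n := qlift trace_graph_relation.
HB.instance Definition _ := GRing.Linear.on trace.

Lemma traceE G : trace (gclass G) = trace_graph G.
Proof. by rewrite /trace qliftE /= /trace_free fliftU. Qed.

Lemma trace_large x : (n * 3 < r)%N -> trace x = 0.
Proof.
move=> nr; have t0 G : trace_graph G = 0.
  apply: big1 => M /andP[gM _]; suff: (r <= n * 3)%N by rewrite leqNgt nr.
  have /and3P[/eqP<- _ _] := gM.
  have -> : #|M| = #|@fst _ _ @: M|.
    rewrite card_in_imset // => p q pM qM pq.
    by apply: (pairing_eq (x := p.1) gM) => //; rewrite ?eqxx // pq eqxx.
  by rewrite (leq_trans (max_card _)) // card_prod !card_ord.
elim/proj_ind: x => D; rewrite /trace qliftE -[D]freeg_sumE raddf_sum big1 // => G _.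
by rewrite /= /trace_free /flift liftU t0 scaler0.
Qed.
End Trace.

(* beta^k on C_{k+1,k+r}H^ord(n). *)
Fixpoint beta_iter k r n : C k.+1 (k + r) n -> C 1 r n :=
  match k return C k.+1 (k + r) n -> C 1 r n with
  | 0 => id
  | k'.+1 => fun x => beta_iter (beta (x : C k'.+2 (k' + r).+1 n))
  end.

(* Omega_tilde r m is the quotient in Lie degree n = m + 1. *)
Definition image_beta r m (y : C 1 r m.+1) :=
  exists x : C m.+1 (m + r) m.+1, y = beta_iter x.

Definition Omega_tilde r m := quotient (@image_beta r m).

(* With vertex v = t.1 carrying, in cyclic order, the half-edges t (ending at
   p), next t (a hair) and next (next t) (carrying the univalent vertex X, which
   is joined to the univalent vertex Y of q): v is cut from p and glued to q so
   that X now sits at p and Y sits at t.  The vertex v is thus reused as the new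
   trivalent vertex, in the cyclic order (edge to Y, hair, other edge).  When t
   ends at a univalent vertex, the tree is a tripod, that vertex is Y, and the
   sliding relation is trivial. *)
Definition slide n k (t p q : hedge n) (g : pregraph n k) := Pregraph
  [ffun y => if y == p then Dotted true t
             else if y == t then Dotted false p
             else if y == next (next t) then Solid q
             else if y == q then Solid (next (next t))
             else att g y]
  (tree g).

Inductive omega_relation r n : C 1 r n -> Prop :=
| rel_C1 (G : hgraph 1 r n) h b h' : att G h = Dotted b h' -> h.1 = h'.1 ->
    omega_relation (gclass G)
| rel_C2 (G G' : hgraph 1 r n) t p x q : att G t = Solid p ->
    att G (next t) = Hair n x -> att G (next (next t)) = Dotted true q ->
    hg G' = slide t p q G ->
    omega_relation (gclass G - gclass G')
| rel_C3 (G : hgraph 2 r.+1 n) v (q : 'I_3 -> hedge n) :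
    (forall u, tree G u = 0 :> nat <-> u = v) ->
    (forall i, att G (v, i) = Dotted true (q i)) ->
    (forall i, tree G (q i).1 = 1%N :> nat) ->
    omega_relation (\sum_i pclass r (join (v, i) (q i) G)).

Definition Omega r m := quotient (@omega_relation r m.+1).

(* Direct sums over n = m + 1 >= 1 and r = s + 1 >= 1; the index is (m, s). *)
Definition h_total := dsum (fun m : nat => C 1 0 m.+1).
Definition Omega_tilde_total := dsum (fun i : nat * nat => Omega_tilde i.2.+1 i.1).
Definition Omega_total := dsum (fun i : nat * nat => Omega i.2.+1 i.1).

Section TotalTrace.
Variable omega : {skew_symmetric H}.
Variables (W : nat * nat -> lmodType rat)
  (pi : forall i, {linear C 1 i.2.+1 i.1.+1 -> W i}).

Lemma total_trace_fin (x : h_total) : exists s : seq (nat * nat),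
  forall i, i \notin s -> pi i (trace i.2.+1 omega (x i.1)) = 0.
Proof.
have [s xs] := component_fin x.
exists [seq (m, r) | m <- s, r <- iota 0 (m.+1 * 3)] => -[m r] out.
have [ms|/xs xms] := boolP (m \in s); last by rewrite /= xms !linear0.
rewrite /= trace_large ?linear0 // ltnS leqNgt; apply: contra out => rm.
by apply: (allpairs_f_dep (fun m r : nat => (m, r)) ms); rewrite mem_iota.
Qed.

(* The sum of the maps pi o Tr_r over all r >= 1. *)
Definition total_trace (x : h_total) : dsum W := DSum (total_trace_fin x).

Lemma total_trace_is_linear : linear total_trace.
Proof. by move=> a x y; apply: dsumP => i /=; rewrite !linearP. Qed.
HB.instance Definition _ := GRing.isLinear.Build rat h_total (dsum W) *:%R
  total_trace total_trace_is_linear.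
End TotalTrace.

Definition trace_tilde (omega : {skew_symmetric H}) : h_total -> Omega_tilde_total :=
  total_trace omega (fun i => proj (@image_beta i.2.+1 i.1)).
HB.instance Definition _ omega := GRing.Linear.on (trace_tilde omega).

Definition trace_C (omega : {skew_symmetric H}) : h_total -> Omega_total :=
  total_trace omega (fun i => proj (@omega_relation i.2.+1 i.1.+1)).
HB.instance Definition _ omega := GRing.Linear.on (trace_C omega).

(* The class of x in C_{1,s+1}H(m+1). *)
Definition in_Omega_tilde m s (x : C 1 s.+1 m.+1) : Omega_tilde_total :=
  dsum_in (V := fun i => Omega_tilde i.2.+1 i.1) (i := (m, s)) (proj _ x).
Definition in_Omega m s (x : C 1 s.+1 m.+1) : Omega_total :=
  dsum_in (V := fun i => Omega i.2.+1 i.1) (i := (m, s)) (proj _ x).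

End Graphs.

(* Main.v *)
(* Only the vanishing of beta^{n-1}(X) in Omega, for X a union of n tripods with
   n - 1 + r dotted edges and r >= 1, has to be shown.  It holds more generally
   for graphs in which all dotted edges of a tree are attached to one and the
   same trivalent vertex (so that the rest of the tree consists of branches
   without dotted edges), by induction on the number of trees.  For one tree, C1
   applies.  Otherwise consider the dotted edges of the last tree T.  If one of
   them joins T to itself, C1 applies to all the terms.  If none leaves T, the sum
   is empty.  If exactly one leaves T, every term makes it solid, so T may be
   absorbed first, which leaves one tree less.  If two leave T, the last step of
   beta^{n-1} makes one of them solid and keeps the other, and C2, applied to the
   whole third branch of T, shows that the two results cancel.  If three leave T,
   then T is a tripod and C3 applies. *)
Require Import Defs.
From HB Require Import structures.
From mathcomp Require Import all_boot all_order all_fingroup all_algebra.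
From mathcomp Require Import boolp freeg.
(* [next] is the rotation of half-edges, not [path.next]. *)
Import Defs.

Set Implicit Arguments.
Unset Strict Implicit.
Unset Printing Implicit Defensive.
Import GRing.Theory.
Local Open Scope ring_scope.

(** * Half-edges and the shape of trees *)

Section HalfEdges.
Variable n : nat.
Implicit Types h y : hedge n.

Lemma next3 h : next (next (next h)) = h.
Proof.
case: h => v i; congr pair; apply: val_inj => /=.
by case: i => -[|[|[|i]]].
Qed.

Lemma next2_neq h : next (next h) != h.
Proof. by rewrite -{2}[h]next3 eq_sym next_neq. Qed.

Lemma same_vertex h y :
  y.1 = h.1 -> [\/ y = h, y = next h | y = next (next h)].
Proof.
case: h y => v [i iP] [_ [j jP]] /= ->.
case: i iP => [|[|[|i]]] iP //; case: j jP => [|[|[|j]]] jP //;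
  by [constructor 1; congr pair; apply: val_inj
     |constructor 2; congr pair; apply: val_inj
     |constructor 3; congr pair; apply: val_inj].
Qed.
End HalfEdges.

(** [d] is the length of a shortest path from [v]; the last but one vertex of such a path is the
    closer neighbour. *)
Lemma distance_to (T : finType) (e : rel T) (v : T) :
  (forall u, connect e v u) -> symmetric e ->
  exists d : T -> nat, d v = 0%N /\
    forall u, u != v -> exists2 w, e u w & (d w < d u)%N.
Proof.
move=> con sym.
pose reach m u := [exists p : m.-tuple T, path e v p && (last v p == u)].
have reachP u : exists m, reach m u.
  have /connectP[p ep lp] := con u; exists (size p).
  by apply/existsP; exists (in_tuple p); rewrite ep -lp eqxx.
pose d u := ex_minn (reachP u).
have dle p : path e v p -> (d (last v p) <= size p)%N.
  move=> ep; rewrite /d; case: ex_minnP => m _; apply.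
  by apply/existsP; exists (in_tuple p); rewrite ep eqxx.
exists d; split; first by apply/eqP; rewrite -leqn0; apply: (dle [::]).
move=> u uv; case: {1 2}(d u) / erefl (erefl (d u)) => _.
have : reach (d u) u by rewrite /d; case: ex_minnP.
case/existsP => p /andP[ep /eqP lp].
case/lastP E : (tval p) => [|q x]; first by rewrite E /= in lp; rewrite lp eqxx in uv.
move: ep lp; rewrite E rcons_path last_rcons => /andP[eq ex] xu.
exists (last v q); first by rewrite sym -xu.
by rewrite (leq_ltn_trans (dle q eq)) // -(size_tuple p) E size_rcons.
Qed.

Section Graphs.
Variables (H : lmodType rat) (n : nat).
Implicit Types (h y z : hedge n).

Lemma consistent_adjacent k (g : pregraph H n k) :
  consistent g -> symmetric (adjacent g).
Proof.
move=> cg; suff sub u v : adjacent g u v -> adjacent g v u.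
  by move=> u v; apply/idP/idP; apply: sub.
case/existsP=> i /existsP[j /eqP /(consistent_solid cg)[_ gj _]].
by apply/existsP; exists j; apply/existsP; exists i; rewrite gj.
Qed.

Lemma solid_adjacent k (g : pregraph H n k) y z :
  att g y = Solid H z -> adjacent g y.1 z.1.
Proof.
move=> gy; apply/existsP; exists y.2; apply/existsP; exists z.2.
by rewrite -!surjective_pairing gy.
Qed.

Lemma adjacentP k (g : pregraph H n k) u v : reflect
  (exists y z, [/\ att g y = Solid H z, y.1 = u & z.1 = v]) (adjacent g u v).
Proof.
apply: (iffP idP) => [/existsP[i /existsP[j /eqP gi]]|[y [z [gy <- <-]]]].
  by exists (u, i), (v, j).
exact: solid_adjacent gy.
Qed.

Lemma connected1 (g : pregraph H n 1) u v :
  connected_trees g -> connect (adjacent g) u v.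
Proof.
by case/andP=> _ /forallP/(_ u)/forallP/(_ v)/implyP; apply; rewrite !ord1.
Qed.

Definition lower (d : 'I_n -> nat) k (g : pregraph H n k) y :=
  if att g y is Solid z then (d z.1 < d y.1)%N else false.

(* The half-edges leading to the parents and their opposites are 2(n - 1) solid
   half-edges, hence they are all of them. *)
Lemma tree_depth r (g : pregraph H n 1) v : hairy_lie r g ->
  exists d : 'I_n -> nat, [/\ d v = 0%N,
    forall y z, att g y = Solid H z -> d y.1 != d z.1 &
    forall y z, y.1 = z.1 -> lower d g y -> lower d g z -> y = z].
Proof.
case/hairyP=> cg con ag _.
have [d [d0 dP]] := @distance_to _ (adjacent g) v (fun u => connected1 v u con)
  (consistent_adjacent cg).
(* The implication makes [xchoose] available at every [u]; at the root [v], which has no parent, its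
   value is arbitrary. *)
have lowP u : exists y, (u != v) ==> ((y.1 == u) && lower d g y).
  have [->|/dP[w /adjacentP[y [z [gy yu zw]]] dw]] := eqVneq u v.
    by exists (v, ord0).
  by exists y; subst u w; rewrite /lower gy dw eqxx.
pose par u := xchoose (lowP u).
have parP u : u != v -> (par u).1 = u /\ lower d g (par u).
  by move=> uv; have /implyP/(_ uv)/andP[/eqP] := xchooseP (lowP u).
pose opp y := if att g y is Solid z then z else y.
pose A := par @: [set~ v].
have AP y : y \in A -> lower d g y.
  by case/imsetP=> u; rewrite !inE => /parP[_ ?] ->.
have lowS y : lower d g y -> exists2 z, att g y = Solid H z & (d z.1 < d y.1)%N.
  by rewrite /lower; case: (att g y) => // z; exists z.
have AB : [disjoint A & opp @: A].
  rewrite disjoint_subset; apply/subsetP => y /AP/lowS[z gy dz].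
  apply/negP => /imsetP[x /AP/lowS[w gx dw]]; rewrite /opp gx => yw.
  have [_ gw _] := consistent_solid cg gx.
  by move: gy dz; rewrite yw gw => -[<-]; rewrite ltnNge ltnW.
have cA : #|A| = n.-1.
  rewrite card_in_imset; first by rewrite cardsC1 card_ord.
  by move=> u w; rewrite !inE => /parP[e _] /parP[e' _] p; rewrite -e -e' p.
have cB : #|opp @: A| = n.-1.
  rewrite card_in_imset // => y z /AP/lowS[y' gy _] /AP/lowS[z' gz _].
  rewrite /opp gy gz => e.
  have [_ gy' _] := consistent_solid cg gy.
  have [_ gz' _] := consistent_solid cg gz.
  by move: gy'; rewrite e gz' => -[].
have all : A :|: opp @: A = [set y | is_solid (att g y)].
  apply/eqP; rewrite eqEcard; apply/andP; split.
    apply/subsetP => y; rewrite !inE => /orP[/AP/lowS[z -> //]|].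
    case/imsetP=> x /AP/lowS[z gx _] ->; rewrite /opp gx.
    by have [_ -> _] := consistent_solid cg gx.
  have := leq_card_setU A (opp @: A); rewrite AB => /leqifP/eqP->.
  have n0 : n.*2 = (n.-1.*2 + 1.*2)%N.
    by rewrite -doubleD addn1 prednK // (leq_ltn_trans (leq0n v)).
  by rewrite cA cB addnn; move/eqP: ag; rewrite n0 => /addIn->.
(* Every solid edge thus runs between a vertex and its parent, so the depths of its two ends
   differ. *)
have solidP y z : att g y = Solid H z -> y \in A \/ z \in A.
  move=> gy; have : y \in A :|: opp @: A by rewrite all inE gy.
  rewrite inE => /orP[|/imsetP[x xA]]; first by left.
  have /lowS[w gx _] := AP _ xA; rewrite /opp gx => yw; right.
  have [_ gw _] := consistent_solid cg gx.
  by move: gy; rewrite yw gw => -[<-].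
have strict y z : att g y = Solid H z -> d y.1 != d z.1.
  move=> gy; have [_ gz _] := consistent_solid cg gy.
  case: (solidP _ _ gy) => /AP; rewrite /lower ?gy ?gz ltn_neqAle => /andP[] //.
  by rewrite eq_sym.
exists d; split=> //.
have lowA y : lower d g y -> y = par y.1.
  move=> ly; have [z gy dz] := lowS _ ly; have [_ gz _] := consistent_solid cg gy.
  case: (solidP _ _ gy) => [|/AP]; last by rewrite /lower gz ltnNge ltnW.
  by case/imsetP=> u; rewrite !inE => /parP[e _] ->; rewrite e.
by move=> y z yz /lowA-> /lowA->; rewrite yz.
Qed.

End Graphs.

Lemma connect_invariant (T : finType) (e : rel T) (A : pred T) u v :
  (forall x y, e x y -> A x -> A y) -> connect e u v -> A u -> A v.
Proof.
move=> eA /connectP[p + ->]; elim: p u => //= w p IH u /andP[uw wp] Au.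
by apply: IH wp _; apply: eA uw Au.
Qed.

(** * Moving half-edges by permutations *)

Section Relabel.
Variables (H : lmodType rat) (n : nat).
Implicit Types (h y z : hedge n) (s : {perm hedge n}) (g : pregraph H n 1).

(** IHX, the reversal of a vertex and the slide all take this form, so composing them amounts to
    multiplying permutations. There is only one tree, so [tree] stays as it is. *)
Definition relabel s g : pregraph H n 1 :=
  Pregraph [ffun y => port_map s (att g ((s^-1)%g y))] (tree g).

Lemma port_map_comp (f f' : hedge n -> hedge n) (p : port H n) :
  port_map f (port_map f' p) = port_map (f \o f') p.
Proof. by case: p. Qed.

Lemma att_relabel s g y : att (relabel s g) (s y) = port_map s (att g y).
Proof. by rewrite ffunE permK. Qed.

Lemma att_relabel_fix s g y : s y = y ->
  (forall z, att g y = Solid H z -> s z = z) ->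
  (forall b z, att g y = Dotted H b z -> s z = z) ->
  att (relabel s g) y = att g y.
Proof.
move=> sy gS gD; rewrite -{1}sy att_relabel.
case E: (att g y) => [z|b z|x] //=; first by rewrite (gS _ E).
by rewrite (gD _ _ E).
Qed.

Lemma relabelM s s' g : relabel (s * s') g = relabel s' (relabel s g).
Proof.
congr Pregraph; apply/ffunP => y; rewrite !ffunE port_map_comp invMg permM.
by case: (att g _) => //= [z|b z]; rewrite permM.
Qed.

Lemma relabelled_relabel s g : relabelled s g (relabel s g).
Proof. by move=> h; rewrite att_relabel. Qed.

Lemma relabel_unique s g g' : relabelled s g g' -> g' = relabel s g.
Proof.
case: g' => a' t' gg'; congr Pregraph; last first.
  by apply/ffunP => u; apply: val_inj; rewrite !ord1.
by apply/ffunP => y; rewrite ffunE -gg' permKV.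
Qed.

Lemma relabel_consistent s g : consistent g -> consistent (relabel s g).
Proof.
move=> cg; apply/forallP => y; rewrite -(permKV s y) att_relabel.
set x := (_ y); case E: (att g x) => [z|b z|c] //=.
  have [zx gz tz] := consistent_solid cg E.
  by rewrite (inj_eq perm_inj) zx att_relabel gz !ord1 !eqxx.
by have [gz _] := consistent_dotted cg E; rewrite att_relabel gz.
Qed.

(** The numbers of solid and dotted half-edges do not change, so only connectedness can fail. An
    edge from [y] to [z] becomes one from [s y] to [s z], and the hypothesis leads from there back
    to the vertices of [y] and [z]. *)
Lemma relabel_hairy r s g : hairy_lie r g ->
  (forall y, connect (adjacent (relabel s g)) (s y).1 y.1) ->
  hairy_lie r (relabel s g).
Proof.
move=> /hairyP[cg con ag dg] sc; have cg' := relabel_consistent s cg.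
have sym : connect_sym (adjacent (relabel s g)).
  exact: sym_connect_sym (consistent_adjacent cg').
have count (P : pred (port H n)) : (forall p, P (port_map s p) = P p) ->
    #|[set h | P (att (relabel s g) h)]| = #|[set h | P (att g h)]|.
  move=> Ps; rewrite -[RHS](card_imset _ (@perm_inj _ s)); apply: eq_card => y.
  rewrite -(permKV s y) (mem_imset _ _ perm_inj) !inE att_relabel.
  exact: Ps.
apply/hairyP; split=> //.
- apply/andP; split; first by case/andP: con.
  apply/forallP => u; apply/forallP => v; apply/implyP => _.
  apply: (connect_sub _ (connected1 u v con)) => {u v} _ _ /adjacentP[y [z [gy <- <-]]].
  apply: connect_trans (sc z); rewrite sym.
  apply: (connect_trans (y := (s y).1)); last exact: sc.
  rewrite sym; apply/connect1/solid_adjacent.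
  by rewrite att_relabel gy.
- by rewrite /acyclic count //; case.
- by rewrite count //; case.
Qed.

End Relabel.

(** * Branches and their slides *)

Section Branch.
Variables (H : lmodType rat) (n : nat).
Implicit Types (h y z : hedge n) (s : seq (hedge n)) (g : pregraph H n 1).

(* The list contains the half-edges of the branch that point away from h. *)
Inductive branch g : hedge n -> seq (hedge n) -> Prop :=
| branch_hair h x : att g h = Hair n x -> branch g h [::]
| branch_node h b s s' : att g h = Solid H b ->
    branch g (next b) s -> branch g (next (next b)) s' ->
    branch g h (next b :: next (next b) :: s ++ s').

(** A branch is determined by the attachments of its root and of the half-edges in [s]; the root may
    thus become another half-edge, as happens when the branch is moved. *)
Lemma branch_eq g g' h h' s : branch g h s -> att g' h' = att g h ->
  {in s, forall y, att g' y = att g y} -> branch g' h' s.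
Proof.
move=> gs; elim: gs h' => {h s} [h x gh|h b s s' gh _ IH _ IH'] h' e es.
  by apply: (branch_hair (x := x)); rewrite e.
apply: branch_node; first by rewrite e gh.
  apply: IH; first by apply: es; rewrite !inE eqxx.
  by move=> y ys; apply: es; rewrite !inE mem_cat ys !orbT.
apply: IH'; first by apply: es; rewrite !inE eqxx orbT.
by move=> y ys; apply: es; rewrite !inE mem_cat ys !orbT.
Qed.

Lemma branch_not_dotted g h s : branch g h s -> is_dotted (att g h) = false.
Proof. by case=> [? ? ->|? ? ? ? ->]. Qed.

Lemma branch_root g h s b : branch g h s -> att g h = Solid H b ->
  next b \in s.
Proof.
by case=> [h' x ->|h' b' s1 s2 -> _ _] // [<-]; rewrite inE eqxx.
Qed.

(** The only solid edge out of a branch is the one at its root, so a walk in the tree can leave it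
    only through the vertex of [h]. *)
Lemma branch_closed g h s y : consistent g -> branch g h s ->
  y.1 \in map fst s -> ~~ is_dotted (att g y) /\
  forall z, att g y = Solid H z -> z.1 = h.1 \/ z.1 \in map fst s.
Proof.
move=> cg; elim=> {h s} [//|h b s s' gh bs IH bs' IH'] /=.
rewrite map_cat !inE mem_cat orbA => /orP[|/orP[/IH|/IH']].
- rewrite orbb => /eqP/same_vertex[] ->.
  + have [_ -> _] := consistent_solid cg gh.
    by split=> // z [<-]; left.
  + rewrite (branch_not_dotted bs); split=> // z /(branch_root bs) zs; right.
    by rewrite !inE mem_cat (map_f fst zs) !orbT.
  + rewrite (branch_not_dotted bs'); split=> // z /(branch_root bs') zs; right.
    by rewrite !inE mem_cat (map_f fst zs) !orbT.
- case=> -> hz; split=> // z /hz[->|zs]; right; rewrite !inE ?eqxx //.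
  by rewrite mem_cat zs !orbT.
- case=> -> hz; split=> // z /hz[->|zs]; right; rewrite !inE ?eqxx //.
  by rewrite mem_cat zs !orbT.
Qed.

Section Depth.
Variables (g : pregraph H n 1) (d : 'I_n -> nat).
Hypothesis cg : consistent g.
Hypothesis strict : forall y z, att g y = Solid H z -> d y.1 != d z.1.
Hypothesis unique_lower :
  forall y z, y.1 = z.1 -> lower d g y -> lower d g z -> y = z.

(** The one half-edge at the vertex of [b] that points to smaller depth is [b] itself, which leads
    back to [h]. *)
Lemma lower_child h b : att g h = Solid H b -> ~~ lower d g h ->
  [/\ (d h.1 < d b.1)%N, ~~ lower d g (next b) & ~~ lower d g (next (next b))].
Proof.
move=> gh; rewrite {1}/lower gh -leqNgt leq_eqVlt (negPf (strict gh)) /= => hb.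
have lb : lower d g b by have [_ gb _] := consistent_solid cg gh; rewrite /lower gb.
split=> //; apply/negP => l.
  by have /eqP := unique_lower (erefl : (next b).1 = b.1) l lb; rewrite (negPf (next_neq _)).
by have /eqP := unique_lower (erefl : (next (next b)).1 = b.1) l lb;
  rewrite (negPf (next2_neq _)).
Qed.

Lemma branch_depth h s : branch g h s -> ~~ lower d g h ->
  {in s, forall y, [/\ (d h.1 < d y.1)%N, ~~ lower d g y & ~~ is_dotted (att g y)]}.
Proof.
elim=> {h s} [//|h b s s' gh bs IH bs' IH'] /(lower_child gh)[hb lb lb'] y.
rewrite !inE mem_cat => /or3P[/eqP->|/eqP->|/orP[]].
- by split=> //; rewrite (branch_not_dotted bs).
- by split=> //; rewrite (branch_not_dotted bs').
- by case/(IH lb) => /(ltn_trans hb).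
- by case/(IH' lb') => /(ltn_trans hb).
Qed.

(** Depth grows along children and is bounded by [m], so the recursion ends. [A] marks a region
    without dotted edges that is closed under passing to children. *)
Lemma branch_exists (A : pred (hedge n)) h :
  (forall y b, A y -> ~~ lower d g y -> att g y = Solid H b ->
     A (next b) /\ A (next (next b))) ->
  (forall y, A y -> ~~ is_dotted (att g y)) ->
  A h -> ~~ lower d g h -> exists s, branch g h s.
Proof.
move=> step nd; pose m := \max_u d u; have dm u : (d u <= m)%N by apply: leq_bigmax.
have [k] := ubnP (m - d h.1)%N; elim: k h => // k IH h hk Ah lh.
have := nd h Ah; case gh: (att g h) => [b|//|x] _; last by exists [::]; apply: branch_hair gh.
have [hb lb lb'] := lower_child gh lh; have [Ab Ab'] := step _ _ Ah lh gh.
have bk : (m - d b.1 < k)%N.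
  by rewrite -ltnS (leq_trans _ hk) // ltnS ltn_sub2l // (leq_trans hb).
have [s bs] := IH (next b) bk Ab lb.
have [s' bs'] := IH (next (next b)) bk Ab' lb'.
by exists (next b :: next (next b) :: s ++ s'); apply: branch_node gh bs bs'.
Qed.
End Depth.

(** Two edges exchange places: the solid edge at [t], [p] goes to [q], [next (next t)], and the
    dotted edge from [next (next t)] to [q] becomes one from [p] to [t]. *)
Definition slide_perm (t p q : hedge n) : {perm hedge n} :=
  (tperm t q * tperm p (next (next t)))%g.

Section Slide.
Variables (r : nat) (g : pregraph H n 1) (t p q : hedge n) (s : seq (hedge n)).
Hypothesis gP : hairy_lie r g.
Hypothesis gt : att g t = Solid H p.
Hypothesis gtt : att g (next (next t)) = Dotted H true q.

Lemma slide_neq : [/\ p != t, q != next (next t), p != q, t != q & p != next (next t)].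
Proof.
have [cg _ _ _] := hairyP _ _ gP.
have [pt gp _] := consistent_solid cg gt.
have [gq qt] := consistent_dotted cg gtt.
split=> //; apply/eqP => e; first by rewrite e gq in gp.
  by move: gt; rewrite e gq.
by rewrite e gtt in gp.
Qed.

Lemma slide_permE : let s := slide_perm t p q in
  [/\ s t = q, s p = next (next t), s (next (next t)) = p & s q = t].
Proof.
have [pt qt pq tq ptt] := slide_neq; have tt := next2_neq t.
rewrite /slide_perm !permM; split.
- by rewrite tpermL tpermD // 1?eq_sym.
- by rewrite (tpermD (z := p)) 1?eq_sym // tpermL // eq_sym.
- by rewrite (@tpermD _ t q) // ?tpermR // eq_sym.
- by rewrite tpermR tpermD.
Qed.

Lemma slide_perm_fix y : y \notin [:: t; p; q; next (next t)] ->
  slide_perm t p q y = y.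
Proof.
rewrite !inE !negb_or => /and4P[yt yp yq ytt].
by rewrite /slide_perm permM !tpermD // eq_sym.
Qed.

Lemma slide_relabel : slide t p q g = relabel (slide_perm t p q) g.
Proof.
have [cg _ _ _] := hairyP _ _ gP.
have [_ gp _] := consistent_solid cg gt.
have [gq _] := consistent_dotted cg gtt.
have [pt qt pq tq ptt] := slide_neq; have tt := next2_neq t.
have [st sp stt sq] := slide_permE.
apply: relabel_unique => y; have [|yN] := boolP (y \in [:: t; p; q; next (next t)]).
  rewrite !inE => /or4P[]/eqP->.
  - rewrite st gt /= sp ffunE eq_sym (negPf pq) eq_sym (negPf tq).
    by rewrite (negPf qt) eqxx.
  - rewrite sp gp /= st ffunE (eq_sym _ p) (negPf ptt) (negPf tt).
    by rewrite eqxx.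
  - by rewrite sq gq /= stt ffunE (eq_sym t p) (negPf pt) eqxx.
  - by rewrite stt gtt /= sq ffunE eqxx.
rewrite slide_perm_fix //.
move: (yN); rewrite !inE !negb_or => /and4P[yt yp yq ytt].
rewrite ffunE (negPf yt) (negPf yp) (negPf yq) (negPf ytt).
case gy: (att g y) => [z|b z|x] //=; rewrite slide_perm_fix //.
  have [_ gz _] := consistent_solid cg gy.
  rewrite !inE !negb_or; apply/and4P; split; apply/eqP => e; move: gz;
    rewrite e ?gt ?gp ?gq ?gtt //.
    by move=> [e']; rewrite e' eqxx in yp.
  by move=> [e']; rewrite e' eqxx in yt.
have [gz _] := consistent_dotted cg gy.
rewrite !inE !negb_or; apply/and4P; split; apply/eqP => e; move: gz; rewrite e ?gt ?gp ?gq ?gtt //.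
  by move=> [_ e']; rewrite e' eqxx in ytt.
by move=> [_ e']; rewrite e' eqxx in yq.
Qed.

Hypothesis bs : branch g (next t) s.

(* The branch at [next t] carries no dotted edge, so cutting the edge from [t]
   to [p] leaves [q] on the side of [p]. *)
Lemma slide_hairy : hairy_lie r (relabel (slide_perm t p q) g).
Proof.
have [cg con _ _] := hairyP _ _ gP.
have [_ gp _] := consistent_solid cg gt.
have [gq _] := consistent_dotted cg gtt.
have [pt qt pq tq ptt] := slide_neq.
have [st sp stt sq] := slide_permE.
apply: relabel_hairy => //; set g' := relabel _ g.
have cg' : consistent g' by apply: relabel_consistent.
have sym : connect_sym (adjacent g').
  exact: sym_connect_sym (consistent_adjacent cg').
(* [g0] is [g] cut at the edge between [t] and [p], with hairs of color 0 at the two cut ends. *)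
pose g0 := set_hair t 0 (set_hair p 0 g).
have g0P y z : att g0 y = Solid H z -> [/\ y != t, y != p & att g y = Solid H z].
  by rewrite !ffunE; case: eqP => // _; case: eqP.
have sub : subrel (connect (adjacent g0)) (connect (adjacent g')).
  apply: connect_sub => _ _ /adjacentP[y [z [/g0P[yt yp gy] <- <-]]].
  have [_ gz _] := consistent_solid cg gy.
  apply/connect1/solid_adjacent.
  rewrite -(slide_perm_fix (y := y)) ?att_relabel ?gy /= ?slide_perm_fix //.
    rewrite !inE !negb_or; apply/and4P; split; apply/eqP => e; move: gz;
    rewrite e ?gt ?gp ?gq ?gtt //.
      by move=> [e']; rewrite e' eqxx in yp.
    by move=> [e']; rewrite e' eqxx in yt.
  rewrite !inE !negb_or yt yp /=; apply/andP; split; apply/eqP => e.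
    by rewrite e gq in gy.
  by rewrite e gtt in gy.
have side u : connect (adjacent g0) t.1 u || connect (adjacent g0) p.1 u.
  have := connected1 t.1 u con.
  move/(connect_invariant (A := fun u =>
    connect (adjacent g0) t.1 u || connect (adjacent g0) p.1 u)).
  apply; last by rewrite connect0.
  move=> _ _ /adjacentP[y [z [gy <- <-]]].
  have [yt|yt] := eqVneq y t.
    by move: gy; rewrite yt gt => -[<-] _; rewrite connect0 orbT.
  have [yp|yp] := eqVneq y p.
    by move: gy; rewrite yp gp => -[<-] _; rewrite connect0.
  have e : connect (adjacent g0) y.1 z.1.
    by apply/connect1/solid_adjacent; rewrite !ffunE (negPf yt) (negPf yp).
  by case/orP=> /connect_trans/(_ e) ->; rewrite ?orbT.
(* The side of [t] consists of its vertex and the branch, and the only dotted half-edge there is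
   [next (next t)]; hence [q] lies on the side of [p]. *)
have pq_side : connect (adjacent g0) p.1 q.1.
  case/orP: (side q.1) => // tq1.
  have : (q.1 == t.1) || (q.1 \in map fst s).
    apply: (connect_invariant (A := fun u => (u == t.1) || (u \in map fst s)) _ tq1).
      move=> _ _ /adjacentP[y [z [/g0P[yt yp gy] <- <-]]] /orP[/eqP/same_vertex[] e|ys].
      - by rewrite e eqxx in yt.
      - by apply/orP; right; rewrite e in gy; apply: (map_f fst (branch_root bs gy)).
      - by rewrite e gtt in gy.
      - by have [_ /(_ _ gy)[->|->]] := branch_closed cg bs ys; rewrite ?eqxx ?orbT.
    by rewrite eqxx.
  move=> /orP[/eqP/same_vertex[] e|qs].
  - by move: tq; rewrite e eqxx.
  - by have := branch_not_dotted bs; rewrite -e gq.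
  - by rewrite e eqxx in qt.
  - by have [] := branch_closed cg bs qs; rewrite gq.
have tq_conn : connect (adjacent g') t.1 q.1.
  apply: connect1; apply: (solid_adjacent (y := next (next t))).
  by rewrite -sp att_relabel gp /= st.
have tp_conn : connect (adjacent g') t.1 p.1.
  by apply: connect_trans tq_conn _; rewrite sym; apply: sub.
move=> y; have [|yN] := boolP (y \in [:: t; p; q; next (next t)]); last first.
  by rewrite slide_perm_fix.
rewrite !inE => /or4P[]/eqP->; rewrite ?st ?sp ?sq ?stt //; by rewrite sym.
Qed.
End Slide.
End Branch.

(** * Sliding a branch across a dotted edge *)

Lemma tperm_if (T : finType) (x y z : T) :
  tperm x y z = if z == x then y else if z == y then x else z.
Proof. by case: tpermP => [->|->|/eqP/negPf-> /eqP/negPf->]; rewrite ?eqxx //; case: eqP. Qed.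

(* From [u : uniq s], the rewriting rules [(x == y) = false] for [x], [y] in s. *)
Ltac uniq_neq u ne := 
  move: (u); rewrite /= !inE !negb_or !andbT -!andbA;
  let rec go acc := (lazymatch goal with
   | |- is_true (_ && _) -> _ => let h := fresh "ne" in let h' := fresh "ne" in
       move=> /andP[h]; have h' := h; rewrite eq_sym in h';
       apply negbTE in h; apply negbTE in h'; go (acc, h, h')
   | |- is_true _ -> _ => let h := fresh "ne" in let h' := fresh "ne" in
       move=> h; have h' := h; rewrite eq_sym in h';
       apply negbTE in h; apply negbTE in h'; have ne := (acc, h, h') end) in go (erefl true).

Ltac perm_eval ne :=
  rewrite ?permM;
  repeat match goal with
  | |- context [fun_of_perm (tperm ?x ?y) ?z] =>
      is_var z; rewrite (tperm_if x y z) ?eqxx ?ne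
  end.

(** For distinct arguments this is [rotate3] as a permutation: [x], [y], [z] go to [z], [x], [y]. *)
Definition cycle3 (T : finType) (x y z : T) : {perm T} := (tperm x z * tperm x y)%g.

(* In [omega_slide] the vertex (t, a, c) carries the branch at a, whose first
   vertex is (b, b1, b2); p is the other end of the edge at t, and q that of the
   dotted edge at c.  Moving the half-edges by rho is one step of IHX at the edge
   (a, b), and slide0 is the slide to be achieved.  The remaining permutations
   first apply IHX and then slide the branches at b1 and b2 one after the other;
   up to exchanging the two solid edges (a, b) and (t, p), the result is that of
   slide0 followed by IHX. *)
Section SlidePaths.
Variables (T : finType) (t a c b b1 b2 p q : T).
Hypothesis u : uniq [:: t; a; c; b; b1; b2; p; q].

Local Notation E := ([set y in [:: t; a; c; b; b1; b2; p; q]]).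
Local Notation slide0 := ((tperm t q * tperm p c)%g).
Local Notation rho := (cycle3 c t b1).


Lemma tperm_on_mem (S : {set T}) x y : x \in S -> y \in S -> perm_on S (tperm x y).
Proof.
move=> xS yS; apply: subset_trans (tperm_on x y) _.
by apply/subsetP => z; rewrite !inE => /orP[]/eqP->.
Qed.

Lemma perm_on_eq (S : {set T}) (s s' : {perm T}) :
  perm_on S s -> perm_on S s' -> {in S, s =1 s'} -> s = s'.
Proof.
move=> sS s'S ss'; apply/permP => y; have [/ss' //|yN] := boolP (y \in S).
by rewrite !(out_perm _ yN).
Qed.

(** The [s] path applies IHX twice and slides the branch at [b1], then the one at [b2]. The [r] path
    applies IHX once, reverses the vertex of [b1], slides the branch at [b2], then the one at [b1],
    and reverses again. *)
Local Notation s0 := ((rho * rho)%g).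
Local Notation s1 := ((s0 * (tperm a q * tperm b t))%g).
Local Notation s2 := ((s1 * (tperm b1 a * tperm p b))%g).
Local Notation r0 := ((rho * tperm b1 b2)%g).
Local Notation r1 := ((r0 * (tperm b q * tperm a b2))%g).
Local Notation r2 := ((r1 * (tperm c b * tperm p a) * tperm b1 b2)%g).

Ltac supported := rewrite ?(perm_onM, tperm_on_mem) // !inE ?eqxx ?orbT.

Lemma path_on : [/\ perm_on E s0, perm_on E s1, perm_on E r0, perm_on E r1 &
  perm_on E rho /\ perm_on E slide0].
Proof. by split; [supported..|split; supported]. Qed.

Lemma rho_fix : [/\ rho a = a & rho b = b].
Proof. by uniq_neq u ne; rewrite /cycle3; split; perm_eval ne. Qed.

Lemma slide0_fix : [/\ slide0 a = a & slide0 b = b].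
Proof. by uniq_neq u ne; split; perm_eval ne. Qed.

Lemma path_s0 : [/\ s0 a = a, s0 b = b, s0 b1 = c, s0 c = t & s0 q = q].
Proof. by uniq_neq u ne; rewrite /cycle3; split; perm_eval ne. Qed.

Lemma path_s1 : [/\ s1 t = b1, s1 p = p, s1 b2 = b2, s1 c = b & s1 q = a].
Proof. by uniq_neq u ne; rewrite /cycle3; split; perm_eval ne. Qed.

(** All factors are supported on the eight half-edges of [E], so comparing values there suffices.
    The leading factor exchanges two solid edges and is absorbed by [solid_swap]. *)
Lemma path_s2 : s2 = (tperm a t * tperm b p * (slide0 * s0))%g.
Proof.
uniq_neq u ne; apply: (perm_on_eq (S := E)); [by supported..|].
move=> y; rewrite /cycle3 !inE.
by do ![case/orP]; move=> /eqP->; perm_eval ne.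
Qed.

Lemma path_r0 : [/\ r0 b = b, r0 a = a, r0 b2 = b1, r0 c = b2 & r0 q = q].
Proof. by uniq_neq u ne; rewrite /cycle3; split; perm_eval ne. Qed.

Lemma path_r1 : [/\ r1 t = c, r1 p = p, r1 b1 = t, r1 c = a & r1 q = b].
Proof. by uniq_neq u ne; rewrite /cycle3; split; perm_eval ne. Qed.

Lemma path_r2 : r2 = (tperm a p * tperm b t * (slide0 * rho))%g.
Proof.
uniq_neq u ne; apply: (perm_on_eq (S := E)); [by supported..|].
move=> y; rewrite /cycle3 !inE.
by do ![case/orP]; move=> /eqP->; perm_eval ne.
Qed.

End SlidePaths.

(** * The defining relations in terms of permuted half-edges *)

Section Relations.
Variables (H : lmodType rat) (r n : nat).
Implicit Types (h y z : hedge n) (g : pregraph H n 1).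
Notation pc := (@pclass H 1 r n).

Lemma relabel_automorphism (s : {perm hedge n}) g :
  relabelled s g g -> relabel s g = g.
Proof. by move=> gg; rewrite -(relabel_unique gg). Qed.

Lemma relabelled_eq (f : hedge n -> hedge n) (s : {perm hedge n}) g :
  s =1 f -> relabelled f g (relabel s g).
Proof.
by move=> sf y; rewrite -sf att_relabel; case: (att g y) => //= [z|b z]; rewrite sf.
Qed.

(** Edges have no names: exchanging two solid edges end by end only permutes equal data. *)
Lemma solid_swap g a b t p : consistent g -> uniq [:: a; b; t; p] ->
  att g a = Solid H b -> att g t = Solid H p ->
  relabel (tperm a t * tperm b p) g = g.
Proof.
move=> cg u ga gt; have [_ gb _] := consistent_solid cg ga.
have [_ gp _] := consistent_solid cg gt.
uniq_neq u ne; pose s := (tperm a t * tperm b p)%g.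
have [sa sb st sp] : [/\ s a = t, s b = p, s t = a & s p = b].
  by rewrite /s; split; perm_eval ne.
have sN y : y \notin [:: a; b; t; p] -> s y = y.
  rewrite !inE !negb_or => /and4P[ya yb yt yp].
  by rewrite permM !tpermD // eq_sym.
apply: relabel_automorphism => y; rewrite -/s.
have [|yN] := boolP (y \in [:: a; b; t; p]).
  rewrite !inE => /or4P[]/eqP->; rewrite ?(sa, sb, st, sp).
  - by rewrite gt ga /= sb.
  - by rewrite gp gb /= sa.
  - by rewrite gt ga /= sp.
  - by rewrite gp gb /= st.
rewrite sN //; case gy: (att g y) => [z|c z|x] //=; rewrite sN //.
  have [_ gz _] := consistent_solid cg gy.
  apply: contra yN; rewrite !inE => /or4P[] /eqP e; move: gz; rewrite e;
    by rewrite ?(ga, gb, gt, gp) => -[->]; rewrite eqxx ?orbT.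
have [gz _] := consistent_dotted cg gy.
by rewrite !inE; apply/or4P => -[]/eqP e; move: gz; rewrite e ?(ga, gb, gt, gp).
Qed.

Lemma flip_hairy g h : hairy_lie r g ->
  hairy_lie r (relabel (tperm h (next h)) g).
Proof.
move=> gP; apply: relabel_hairy => // y.
by case: tpermP => [->|->|] *; rewrite connect0.
Qed.

Lemma flip_vertexK v : involutive (@flip_vertex n v).
Proof.
move=> [u i]; rewrite /flip_vertex /=; case: (u =P v) => /= [->|/eqP/negPf->] //.
by rewrite eqxx rev_ordK.
Qed.

(** At the vertex of [h] the composite is a product of two transpositions of three half-edges, hence
    a rotation; elsewhere it is the identity. *)
Lemma flip_vertex_next h y : let f := tperm h (next h) \o flip_vertex h.1 in
  f (next y) = next (f y).
Proof.
rewrite /= /flip_vertex /=; case: (eqVneq y.1 h.1) => [yh|yh]; last first.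
  by rewrite !tpermD //; apply: contraNneq yh => /(congr1 fst) /= ->.
case: y yh => _ j /= ->; case: h => v i /=.
have E (k l : 'I_3) : ((v, k) == (v, l) :> hedge n) = (k == l) by rewrite xpair_eqE eqxx.
rewrite !tperm_if /next /= !E.
by case: i => [[|[|[|i]]] iP] //; case: j => [[|[|[|j]]] jP] //; congr pair; apply: val_inj.
Qed.

(** [flip_vertex] always exchanges the half-edges numbered 0 and 2. By [flip_vertex_next],
    exchanging [h] with [next h] differs from it by an isomorphism, so AS gives the sign here
    too. *)
Lemma pclass_flip g h : hairy_lie r g ->
  pc g = - pc (relabel (tperm h (next h)) g).
Proof.
move=> gP; pose phi := perm (@flip_vertex_inj n h.1).
have phiP : hairy_lie r (relabel phi g).
  by apply: relabel_hairy => // y; rewrite permE flip_vertex1 connect0.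
rewrite (@pclass_as _ _ _ _ g (relabel phi g) h.1) //; last first.
  by apply: relabelled_eq => y; rewrite permE.
congr (- _); apply: pclass_iso => //; first exact: flip_hairy.
have phi2 : (phi * phi = 1)%g.
  by apply/permP => y; rewrite permM perm1 !permE flip_vertexK.
have -> : relabel (tperm h (next h)) g = relabel (phi * tperm h (next h)) (relabel phi g).
  by rewrite -relabelM mulgA phi2 mul1g.
exists (phi * tperm h (next h))%g; split.
- exact: perm_inj.
- by move=> y; rewrite !permM !(permE (@flip_vertex_inj n h.1)); apply: flip_vertex_next.
- exact: relabelled_relabel.
- by move=> y; rewrite !ord1.
Qed.

Lemma cycle3E h h' : h.1 != h'.1 ->
  cycle3 (next h) (next (next h)) (next h') =1
    rotate3 (next h) (next (next h)) (next h').
Proof.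
move=> hh y; have e1 : next (next h) != next h by apply: next_neq.
have e2 : next h != next h' by apply: contraNneq hh => /(congr1 fst) /= ->.
have e3 : next (next h) != next h' by apply: contraNneq hh => /(congr1 fst) /= ->.
rewrite /cycle3 permM /rotate3 (tperm_if _ _ y).
case: (y =P next h) => [_|/eqP yh]; first by rewrite tpermD // eq_sym.
case: (y =P next h') => [->|/eqP yh'].
  by rewrite tpermL eq_sym (negPf e3).
case: (y =P next (next h)) => [->|/eqP yhh]; first by rewrite tpermR.
by rewrite tpermD // eq_sym.
Qed.

Lemma ihx_fix h h' : h.1 != h'.1 ->
  let s := cycle3 (next h) (next (next h)) (next h') in s h = h /\ s h' = h'.
Proof.
move=> hh; rewrite /= !cycle3E // /rotate3.
have ne : (h == next h') = false.
  by apply: contraNF hh => /eqP/(congr1 fst) /= ->.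
have ne1 : (h' == next h) = false.
  by apply: contraNF hh => /eqP/(congr1 fst) /= ->.
have ne2 : (h' == next (next h)) = false.
  by apply: contraNF hh => /eqP/(congr1 fst) /= ->.
by rewrite ne ne1 ne2 !(eq_sym _ (next _)) (negPf (next_neq _)) (negPf (next2_neq _))
  (negPf (next_neq _)).
Qed.

(** The edge from [h] to [h'] is fixed, and the half-edges that move stay at its two end vertices,
    so connectedness is kept. *)
Lemma ihx_hairy g h h' : hairy_lie r g -> att g h = Solid H h' -> h.1 != h'.1 ->
  hairy_lie r (relabel (cycle3 (next h) (next (next h)) (next h')) g).
Proof.
move=> gP gh hh; have [cg _ _ _] := hairyP _ _ gP.
set s := cycle3 _ _ _; have [sh sh'] := ihx_fix hh.
have sym := sym_connect_sym (consistent_adjacent (relabel_consistent s cg)).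
have e : connect (adjacent (relabel s g)) h.1 h'.1.
  by apply/connect1/solid_adjacent; rewrite -{1}sh att_relabel gh /= sh'.
apply: relabel_hairy => // y; rewrite cycle3E // /rotate3.
case: eqP => [->|_]; first by rewrite sym.
case: eqP => [->|_]; first exact: connect0.
by case: eqP => [->|_]; last exact: connect0.
Qed.

Lemma pclass_ihx_relabel g h h' : hairy_lie r g -> att g h = Solid H h' ->
  h.1 != h'.1 ->
  let s := cycle3 (next h) (next (next h)) (next h') in
  pc g + pc (relabel s g) + pc (relabel (s * s) g) = 0.
Proof.
move=> gP gh hh s; rewrite (relabelM s s); have [sh sh'] := ihx_fix hh.
have gP1 := ihx_hairy gP gh hh.
have gh1 : att (relabel s g) h = Solid H h'.
  by rewrite -{1}sh att_relabel gh /= sh'.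
apply: (pclass_ihx (h := h) (h' := h')) => //.
- exact: (ihx_hairy gP1 gh1 hh).
- by apply: relabelled_eq => y; apply: cycle3E.
- by apply: relabelled_eq => y; apply: cycle3E.
Qed.

Definition to_omega : C H 1 r n -> quotient (@omega_relation H r n) :=
  proj (@omega_relation H r n).
HB.instance Definition _ := GRing.Linear.on to_omega.

End Relations.

(** * Induction on the size of the branch *)

Section OmegaSlide.
Variables (H : lmodType rat) (r n : nat).
Implicit Types (h y z : hedge n) (g : pregraph H n 1).
Notation pc := (@pclass H 1 r n).
Notation to_omega := (@to_omega H r n).

Lemma branchP g h s : branch g h s ->
  (exists2 x, att g h = Hair n x & s = [::]) \/
  exists b s1 s2, [/\ att g h = Solid H b, branch g (next b) s1,
    branch g (next (next b)) s2 & s = next b :: next (next b) :: s1 ++ s2].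
Proof.
case=> [{}h x gh|{}h b s1 s2 gh bs1 bs2]; first by left; exists x.
by right; exists b, s1, s2.
Qed.

(* Sliding a branch without dotted edges across a dotted edge: by IHX the branch
   is a signed sum of two consecutive smaller branches, slid one after the
   other. *)
Lemma omega_slide s g t p q : hairy_lie r g -> att g t = Solid H p ->
  att g (next (next t)) = Dotted H true q -> branch g (next t) s ->
  to_omega (pc g) = to_omega (pc (relabel (slide_perm t p q) g)).
Proof.
have [m] := ubnP (size s); elim: m s g t p q => // m IH s g t p q sm gP gt gc bs.
have gP' := slide_hairy gP gt gc bs.
(* A branch consisting of a single hair is the case of C2 itself. *)
case/branchP: (bs) sm => [[x ga _] _|[b [s1 [s2 [ga bs1 bs2 ->]]]]].
  apply/eqP; rewrite -subr_eq0 -raddfB; apply/eqP/proj_eq0; rewrite !pclassE.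
  apply: (rel_C2 (t := t) (p := p) (x := x) (q := q)) => //=.
  by rewrite (slide_relabel gP gt gc).
rewrite /= size_cat ltnS => /ltnW sm.
set a := next t in ga bs *; set c := next a in gc *.
set b1 := next b in bs1 *; set b2 := next b1 in bs2 *.
have [cg _ _ _] := hairyP _ _ gP.
(* Depth from the vertex of [t] separates that vertex from the rest of the tree, and the two smaller
   branches from [p], which points back to the root. *)
have [d [d0 strict unique]] := tree_depth t.1 gP.
have lowa : ~~ lower d g a by rewrite /lower ga d0.
have [hb lb1 lb2] := lower_child cg strict unique ga lowa.
rewrite -/b1 -/b2 /= d0 in hb lb1 lb2.
have [_ gp _] := consistent_solid cg gt.
have [_ gb _] := consistent_solid cg ga.
have [gq _] := consistent_dotted cg gc.
have [pt qc pq tq pc'] := slide_neq gP gt gc; rewrite -/a -/c in qc pc'.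
have ta : t != a by rewrite eq_sym next_neq.
have tc : t != c by rewrite eq_sym next2_neq.
have ac : a != c by rewrite eq_sym next_neq.
have bb1 : b != b1 by rewrite eq_sym next_neq.
have bb2 : b != b2 by rewrite eq_sym next2_neq.
have b12 : b1 != b2 by rewrite eq_sym next_neq.
have dp : (0 < d p.1)%N by have := strict _ _ gt; rewrite d0 lt0n eq_sym.
have lp : lower d g p by rewrite /lower gp d0.
have nv x : x.1 = t.1 -> [/\ x != b, x != b1, x != b2 & x != p].
  have sep y : x.1 = t.1 -> (0 < d y.1)%N -> x != y.
    by move=> xt; apply: contraTneq => <-; rewrite xt d0.
  by move=> xt; split; apply: sep.
have [tb tb1 tb2 tp] := nv t erefl.
have [ab ab1 ab2 ap] := nv a erefl.
have [cb cb1 cb2 cp] := nv c erefl.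
have pb : p != b by apply: contraNneq ta => e; move: gb; rewrite -e gp => -[->].
have pb1 : p != b1 by apply: contraNneq lb1 => <-.
have pb2 : p != b2 by apply: contraNneq lb2 => <-.
have u : uniq [:: t; a; c; b; b1; b2; p; q].
  rewrite /= !inE !negb_or ta tc ac bb1 bb2 b12 tq pq tb tb1 tb2 tp.
  rewrite ab ab1 ab2 ap cb cb1 cb2 cp.
  rewrite [c == q]eq_sym qc /= !andbT.
  have neD x : ~~ is_dotted (att g x) -> x != q by apply: contraNneq => ->; rewrite gq.
  rewrite !neD ?ga ?gb // ?(branch_not_dotted bs1) ?(branch_not_dotted bs2) //=.
  by rewrite ![_ == p]eq_sym pb pb1 pb2.
have u4 : uniq [:: a; b; t; p].
  by rewrite /= !inE !negb_or ab ap tp ![_ == t]eq_sym ta tb [b == p]eq_sym pb.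
have u4' : uniq [:: a; b; p; t].
  by rewrite /= !inE !negb_or ab ap [p == t]eq_sym tp ![_ == t]eq_sym ta tb [b == p]eq_sym pb.
pose E := [set y in [:: t; a; c; b; b1; b2; p; q]].
have mates y z : (d b.1 <= d y.1)%N -> ~~ lower d g y -> y \notin [:: p; b; t; a] ->
    att g y = Solid H z -> z \notin E.
  move=> dy ly yN gy; have [_ gz _] := consistent_solid cg gy.
  have [dz _ _] := lower_child cg strict unique gy ly.
  apply/negP; rewrite /E !inE => zE; move: zE yN.
  by do ![case/orP]; move=> /eqP ez; move: gz dz; rewrite ez ?(gt, ga, gc, gb, gp, gq);
    first [done | by move=> _; rewrite ltnNge dy | by move=> [->]; rewrite !inE eqxx ?orbT].
(* A permutation supported on [E] can move the root of a smaller branch but none of the half-edges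
   inside it, which lie outside [E]. *)
have inner s' y z sx : branch g y sx -> ~~ lower d g y -> d y.1 = d b.1 ->
    y \notin [:: p; b; t; a] -> perm_on E s' -> s' y = z -> branch (relabel s' g) z sx.
  move=> bx ly dy yN sE sy; have out x : x \notin E -> s' x = x by apply: out_perm.
  apply: (branch_eq bx).
    rewrite -sy att_relabel; case gy: (att g y) (branch_not_dotted bx) => [x|//|x] _ //=.
    by rewrite out // (mates _ _ _ ly yN gy) // dy.
  move=> x /(branch_depth cg strict unique bx ly)[dx lx nx].
  have xN : x \notin E.
    rewrite /E !inE; apply/negP; move=> xE; move: xE dx lx nx.
    do ![case/orP]; move=> /eqP ->; rewrite ?dy ?ltnn ?gq //= ?d0 //.
    by rewrite lp.
  apply: att_relabel_fix => [|w gx|e w gx]; first exact: out.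
    apply/out/(mates _ _ _ lx _ gx); first by rewrite -dy ltnW.
    by apply: contra xN; rewrite /E !inE => /or4P[]->; rewrite ?orbT.
  by rewrite gx in nx.
have b1N : b1 \notin [:: p; b; t; a].
  by rewrite !inE !negb_or ![b1 == _]eq_sym pb1 bb1 tb1 ab1.
have b2N : b2 \notin [:: p; b; t; a].
  by rewrite !inE !negb_or ![b2 == _]eq_sym pb2 bb2 tb2 ab2.
(* The induction hypothesis, read after the relabelling [s']: it appends to [s'] the slide of a
   smaller branch across the image of the dotted edge at [c]. *)
have step s' y z w sx : perm_on E s' -> hairy_lie r (relabel s' g) ->
    att g y = Solid H z -> next (next (s' y)) = s' c -> next (s' y) = w ->
    branch (relabel s' g) w sx -> (size sx < m)%N ->
    let s'' := (s' * (tperm (s' y) (s' q) * tperm (s' z) (s' c)))%g in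
    hairy_lie r (relabel s'' g) /\
    to_omega (pc (relabel s' g)) = to_omega (pc (relabel s'' g)).
  move=> sE sP gy yc <- bx szx; rewrite /= relabelM -yc.
  have gy' : att (relabel s' g) (s' y) = Solid H (s' z) by rewrite att_relabel gy.
  have gc' : att (relabel s' g) (next (next (s' y))) = Dotted H true (s' q).
    by rewrite yc att_relabel gc.
  by split; [exact: slide_hairy sP gy' gc' bx | exact: IH szx sP gy' gc' bx].
have ne_ab : a.1 != b.1 by apply: contraTneq hb => ab'; rewrite -ab' d0.
have aa : next a = c by [].
have ca : next (next a) = t by rewrite /a next3.
pose rho := cycle3 c t b1.
have sz1 : (size s1 < m)%N by apply: leq_ltn_trans sm; apply: leq_addr.
have sz2 : (size s2 < m)%N by apply: leq_ltn_trans sm; apply: leq_addl.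
have [s0E s1E r0E r1E [rhoE sE]] := path_on t a c b b1 b2 p q.
have [rhoa rhob] := rho_fix u; have [sla slb] := slide0_fix u.
have rhoN : rho = cycle3 (next a) (next (next a)) (next b) by rewrite ca aa.
have rP : hairy_lie r (relabel rho g) by rewrite rhoN; apply: ihx_hairy.
have gra : att (relabel rho g) a = Solid H b by rewrite -rhoa att_relabel ga /= rhob.
have rrP : hairy_lie r (relabel (rho * rho) g).
  by rewrite relabelM rhoN; apply: ihx_hairy; rewrite -?rhoN.
have tfP : hairy_lie r (relabel (rho * tperm b1 b2) g).
  by rewrite relabelM; apply: flip_hairy.
have [s0a s0b s0b1 s0c s0q] := path_s0 u.
have [s1t s1p s1b2 s1c s1q] := path_s1 u.
have [r0b r0a r0b2 r0c r0q] := path_r0 u.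
have [r1t r1p r1b1 r1c r1q] := path_r1 u.
have := step _ a b c s1 s0E rrP ga.
rewrite s0a s0b s0c s0q => /(_ ca aa (inner _ _ _ _ bs1 lb1 erefl b1N s0E s0b1) sz1).
case=> s1P e1.
have := step _ t p b2 s2 s1E s1P gt.
rewrite s1t s1p s1c s1q next3 => /(_ erefl erefl (inner _ _ _ _ bs2 lb2 erefl b2N s1E s1b2) sz2).
case=> _; rewrite -e1 (path_s2 u) (relabelM (tperm a t * tperm b p)%g).
rewrite (solid_swap cg u4 ga gt) => {e1} e2.
have := step _ b a b1 s2 r0E tfP gb.
rewrite r0b r0a r0c r0q => /(_ erefl erefl (inner _ _ _ _ bs2 lb2 erefl b2N r0E r0b2) sz2).
case=> r1P e3.
have := step _ t p t s1 r1E r1P gt.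
rewrite r1t r1p r1c r1q next3 => /(_ erefl ca (inner _ _ _ _ bs1 lb1 erefl b1N r1E r1b1) sz1).
case=> r2P; rewrite -e3 => {e3} e3.
(* The two reversals of the vertex of [b1] contribute signs that cancel. *)
have e4 : to_omega (pc (relabel rho g)) = to_omega (pc (relabel (slide_perm t p q * rho) g)).
  rewrite (pclass_flip b1 rP) -/b2 -relabelM raddfN /= e3 -raddfN /=; congr to_omega.
  rewrite (pclass_flip b1 r2P) -/b2 opprK -relabelM (path_r2 u).
  by rewrite (relabelM (tperm a p * tperm b t)%g) (solid_swap cg u4' ga gp).
(* IHX is applied before and after the slide. By [e4] and [e2] the second and third terms of the two
   relations agree in the quotient, hence so do the first ones. *)
have ihx := pclass_ihx_relabel gP ga ne_ab; rewrite /= -rhoN in ihx.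
have gsa : att (relabel (slide_perm t p q) g) a = Solid H b.
  by rewrite -sla att_relabel ga /= slb.
have := pclass_ihx_relabel gP' gsa ne_ab; rewrite /= -rhoN -!relabelM => ihx'.
move: (congr1 to_omega ihx) (congr1 to_omega ihx'); rewrite !raddf0 !raddfD /=.
rewrite -e4 -[slide_perm t p q]/(tperm t q * tperm p c)%g -e2 => <- /eqP.
by rewrite eq_sym -!addrA => /eqP/addIr.
Qed.

End OmegaSlide.

(** * Operations on several trees *)

Section Trees.
Variables (H : lmodType rat) (n : nat).
Implicit Types (h y z : hedge n).

Lemma retree_hairy k r (g : pregraph H n k) (t : {ffun 'I_n -> 'I_k}) :
  (forall u v, (t u == t v) = (tree g u == tree g v)) ->
  (forall i, exists u, t u == i) ->
  hairy_lie r g -> hairy_lie r (Pregraph (att g) t).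
Proof.
move=> tt ts /hairyP[cg /andP[_ /forallP con] ag dg].
have adj : adjacent (Pregraph (att g) t) =2 adjacent g by [].
apply/hairyP; split=> //.
- apply/forallP => y; move/forallP: cg => /(_ y) /=.
  by case: (att g y) => // z; rewrite tt.
- apply/andP; split; first by apply/forallP => i; apply/existsP.
  apply/forallP => u; apply/forallP => v; rewrite /= tt (eq_connect adj).
  by have /forallP := con u.
Qed.

Lemma reverse_edge_hairy k r (g : pregraph H n k) h b h' : hairy_lie r g ->
  att g h = Dotted H b h' -> hairy_lie r (reverse_edge h h' g).
Proof.
move=> /hairyP[cg /andP[ne /forallP con] ag dg] gh.
have [gh' hh'] := consistent_dotted cg gh.
have solid y z : att (reverse_edge h h' g) y = Solid H z <-> att g y = Solid H z.
  by rewrite ffunE; case: ifP => // _; case: (att g y).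
have adj : adjacent (reverse_edge h h' g) =2 adjacent g.
  move=> u v; apply/adjacentP/adjacentP => -[y [z [/solid gy <- <-]]];
    by exists y, z; split=> //; apply/solid.
have kind (P : pred (port H n)) : (forall p, P (port_rev p) = P p) ->
    [set y | P (att (reverse_edge h h' g) y)] = [set y | P (att g y)].
  by move=> Pr; apply/setP => y; rewrite !inE ffunE; case: ifP.
apply/hairyP; split=> //.
- apply/forallP => y; rewrite ffunE /=.
  have [->|yh] := eqVneq y h; first by rewrite gh /= ffunE eqxx orbT gh' /= eqxx.
  have [->|yh'] := eqVneq y h'; first by rewrite gh' /= ffunE eqxx gh /= negbK eqxx.
  case gy: (att g y) => [z|c z|x] //=.
    have [zy gz ->] := consistent_solid cg gy; rewrite zy ffunE /= eqxx andbT.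
    by case: ifP => _; rewrite gz.
  have [gz _] := consistent_dotted cg gy; rewrite ffunE.
  have [e|_] := eqVneq z h; first by move: gz yh'; rewrite e gh => -[_ ->]; rewrite eqxx.
  have [e|_] := eqVneq z h'; first by move: gz yh; rewrite e gh' => -[_ ->]; rewrite eqxx.
  by rewrite gz.
- apply/andP; split=> //; apply/forallP => u; apply/forallP => v.
  by rewrite (eq_connect adj); have /forallP := con u.
- by rewrite /acyclic kind //; case.
- by rewrite kind //; case.
Qed.

(** The scalar [e] is 1 or -1; leaving it unspecified suffices for deriving that something
    vanishes. *)
Lemma orient k r (g : pregraph H n k) h b h' : hairy_lie r g ->
  att g h = Dotted H b h' -> exists g' e,
  [/\ hairy_lie r g', pclass r g = e *: pclass r g' /\ tree g' = tree g,
      att g' h = Dotted H true h',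
      forall y, is_dotted (att g' y) = is_dotted (att g y)
    & forall y, y != h -> y != h' -> att g' y = att g y].
Proof.
move=> gP; case: b => gh; first by exists g, 1; split=> //; rewrite scale1r.
have gP' := reverse_edge_hairy gP gh.
exists (reverse_edge h h' g), (-1); split=> //.
- by rewrite scaleN1r; split=> //; apply: (pclass_direction gP gP' gh).
- by rewrite ffunE eqxx gh.
- by move=> y; rewrite ffunE; case: ifP => // _; case: (att g y).
- by move=> y yh yh'; rewrite ffunE (negPf yh) (negPf yh').
Qed.

Lemma merge_val k (i : 'I_k.+2) : merge i = i.-1 :> nat.
Proof. by rewrite /merge inordK //; case: i => -[|i]. Qed.

(** Whereas [join] merges trees 0 and 1, here the last tree takes the number of its partner and all
    other numbers stay. When [h'] lies outside the last tree, [inord] only shrinks the range. *)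
Definition absorb_last k h h' (g : pregraph H n k.+2) : pregraph H n k.+1 :=
  Pregraph (att (join h h' g))
    [ffun u => inord (if tree g u == ord_max then tree g h'.1 else tree g u)].

Section Absorb.
Variables (k r : nat) (g : pregraph H n k.+2) (h h' : hedge n) (b : bool).
Hypothesis gP : hairy_lie r.+1 g.
Hypothesis gh : att g h = Dotted H b h'.
Hypothesis th : tree g h.1 = ord_max.
Hypothesis th' : tree g h'.1 != ord_max.

(** The permutation [s] makes the tree of [h'] the first and the last tree the second; [join_hairy]
    then applies, and [retree_hairy] restores the numbering. *)
Lemma absorb_last_hairy : hairy_lie r (absorb_last h h' g).
Proof.
have [cg /andP[/forallP ne _] _ _] := hairyP _ _ gP.
have [gh' _] := consistent_dotted cg gh.
pose i1 : 'I_k.+2 := inord 1; have i1E : i1 = 1%N :> nat by rewrite inordK.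
pose s0 := tperm (tree g h'.1) ord0.
pose s := (s0 * tperm (s0 ord_max) i1)%g.
have s0m : s0 ord_max != ord0.
  by rewrite -(tpermL (tree g h'.1) ord0) (inj_eq perm_inj) eq_sym.
have sh' : s (tree g h'.1) = ord0.
  by rewrite permM tpermL tpermD // -val_eqE /= i1E.
have sm : s ord_max = i1 by rewrite permM tpermL.
pose g1 := Pregraph (att g) [ffun u => s (tree g u)].
have g1P : hairy_lie r.+1 g1.
  apply: retree_hairy gP => // [u v|i]; first by rewrite !ffunE (inj_eq perm_inj).
  have /existsP[u /eqP tu] := ne ((s^-1)%g i); exists u.
  by rewrite ffunE tu permKV.
have g2P : hairy_lie r (join h' h g1).
  by apply: (join_hairy (b := ~~ b) g1P); rewrite //= ffunE ?sh' ?th ?sm.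
have e : att (join h h' g) = att (join h' h g1).
  apply/ffunP => y; rewrite !ffunE; case: eqP => [->|//].
  by case: eqP => // e; move: th'; rewrite -e th eqxx.
rewrite /absorb_last e; pose m (i : 'I_k.+2) := if i == ord_max then tree g h'.1 else i.
have m_ne i : m i != ord_max by rewrite /m; case: ifP => [|->].
have lt_m i : (m i < k.+1)%N.
  by rewrite ltn_neqAle -ltnS ltn_ord andbT; apply: m_ne.
have s0E i : s i = ord0 -> i = tree g h'.1 by rewrite -sh' => /perm_inj.
have s1E i : s i = 1%N :> nat -> i = ord_max.
  by rewrite -i1E -sm => /val_inj/perm_inj.
apply: retree_hairy g2P => [u v|i].
  rewrite !ffunE -val_eqE /= !inordK ?lt_m // !val_eqE -/(m _) -/(m _).
  apply/eqP/eqP => [|/mergeK[/perm_inj->|[e0 e1]|[e1 e0]]] //; last first.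
  - rewrite (s1E _ e1) (s0E (tree g v)); last exact: val_inj.
    by rewrite /m eqxx (negPf th').
  - rewrite (s1E _ e1) (s0E (tree g u)); last exact: val_inj.
    by rewrite /m eqxx (negPf th').
  rewrite /m; case: eqP => [->|_]; case: eqP => [->|_] // e'; last by rewrite e'.
    by rewrite -e' sh' sm; apply: val_inj; rewrite /= !merge_val i1E.
  by rewrite e' sh' sm; apply: val_inj; rewrite /= !merge_val i1E.
have /existsP[u /eqP tu] := ne (widen_ord (leqnSn _) i); exists u.
rewrite ffunE tu ifN; last by rewrite -val_eqE /= ltn_eqF.
by apply/eqP/val_inj; rewrite /= inordK.
Qed.
End Absorb.
End Trees.

(** * The image of the iterates of beta *)

Section BetaIter.
Variables (H : lmodType rat) (n : nat).
Implicit Types (h y z : hedge n).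

Lemma beta_iter_is_linear k r : linear (@beta_iter H k r n).
Proof. by elim: k => [|k IH] a x y //=; rewrite linearP IH. Qed.
HB.instance Definition _ k r := GRing.isLinear.Build rat (C H k.+1 (k + r) n)
  (C H 1 r n) *:%R (@beta_iter H k r n) (@beta_iter_is_linear k r).

(** This is [beta_term] on pregraphs, so that terms can be rewritten without carrying proofs of
    well-formedness. *)
Definition beta_pterm k r (g : pregraph H n k.+2) y : C H k.+1 r n :=
  if att g y is Dotted out z then
    if (tree g y.1 == 0 :> nat) && (tree g z.1 == 1 :> nat)
    then (-1) ^+ (~~ out) *: pclass r (join y z g) else 0
  else 0.

Lemma beta_pclass k r (g : pregraph H n k.+2) : hairy_lie r.+1 g ->
  beta (pclass r.+1 g) = \sum_y beta_pterm r g y.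
Proof. by move=> gP; rewrite pclassE betaE. Qed.

Lemma beta_ptermP k r (g : pregraph H n k.+2) y (P : C H k.+1 r n -> Prop) : P 0 ->
  (forall b z, att g y = Dotted H b z -> tree g y.1 = 0 :> nat ->
     tree g z.1 = 1%N :> nat -> P ((-1) ^+ (~~ b) *: pclass r (join y z g))) ->
  P (beta_pterm r g y).
Proof.
move=> P0 Pz; rewrite /beta_pterm; case gy: (att g y) => [z|b z|x] //.
by case: ifP => // /andP[/eqP ? /eqP ?]; apply: Pz.
Qed.

(** An invariant [Q] is carried through the joins made while at least three trees are present, which
    leave the last tree alone; only the final step, with two trees, has to be evaluated in the
    quotient. *)
Lemma beta_iter_ind r (Q : forall k, pregraph H n k.+2 -> Prop) :
  (forall k (g : pregraph H n k.+3) h b h', hairy_lie (k.+2 + r) g -> Q _ g ->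
     att g h = Dotted H b h' -> tree g h.1 = 0 :> nat ->
     tree g h'.1 = 1%N :> nat -> Q _ (join h h' g)) ->
  (forall g, hairy_lie r.+1 g -> Q 0%N g ->
     to_omega (\sum_y beta_pterm r g y) = 0) ->
  forall k (g : pregraph H n k.+2), hairy_lie (k.+1 + r) g -> Q k g ->
  to_omega (beta_iter (k := k.+1) (pclass (k.+1 + r) g)) = 0.
Proof.
move=> Qj Q0; elim=> [|k IH] g gP gQ; rewrite /= (beta_pclass gP); first exact: Q0.
have := IH; rewrite /= => {}IH; rewrite !linear_sum big1 // => y _.
apply: (beta_ptermP (P := fun v => to_omega (@beta_iter H k.+1 r n v) = 0))
  => [|b z gy ty tz]; first by rewrite !linear0.
rewrite !linearZ /= IH ?scaler0 //; first exact: join_hairy gP gy ty tz.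
exact: Qj gP gQ gy ty tz.
Qed.

Lemma merge_last k (i : 'I_k.+3) : (merge i == ord_max) = (i == ord_max).
Proof. by rewrite -!val_eqE /= inordK //; case: i => -[|i]. Qed.

Lemma join_att_last k (g : pregraph H n k.+3) h h' y :
  tree g h.1 = 0 :> nat -> tree g h'.1 = 1%N :> nat -> tree g y.1 = ord_max ->
  att (join h h' g) y = att g y.
Proof.
move=> th th' ty; rewrite ffunE; case: eqP => [e|_]; first by rewrite -e ty in th.
by case: eqP => [e|//]; rewrite -e ty in th'.
Qed.

Lemma join_dotted k (g : pregraph H n k.+2) h h' y b z :
  att (join h h' g) y = Dotted H b z -> att g y = Dotted H b z.
Proof. by rewrite ffunE; case: ifP => // _; case: ifP. Qed.

(** The last tree stays isolated up to the final step, whose sum is then empty. *)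
Lemma no_edge_to_last k r (g : pregraph H n k.+2) : hairy_lie (k.+1 + r) g ->
  (forall y b z, att g y = Dotted H b z -> tree g y.1 = ord_max ->
     tree g z.1 = ord_max) ->
  to_omega (beta_iter (k := k.+1) (pclass (k.+1 + r) g)) = 0.
Proof.
move: k g; apply: (@beta_iter_ind r (fun k g => forall y b z,
  att g y = Dotted H b z -> tree g y.1 = ord_max -> tree g z.1 = ord_max)).
- move=> k g h b h' gP Q gh th th' y c z /join_dotted gy.
  by move/eqP; rewrite !ffunE merge_last => /eqP/(Q _ _ _ gy) ->; apply/eqP; rewrite merge_last.
- move=> g gP Q; rewrite big1 ?linear0 // => y _.
  apply: (beta_ptermP (P := fun v => v = 0)) => // b z gy ty tz.
  have [cg _ _ _] := hairyP _ _ gP; have [gz _] := consistent_dotted cg gy.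
  have /(Q _ _ _ gz) e : tree g z.1 = ord_max by apply: val_inj.
  by rewrite e in ty.
Qed.

Lemma C1_pclass r (g : pregraph H n 1) y b z : hairy_lie r g ->
  att g y = Dotted H b z -> y.1 = z.1 -> to_omega (pclass r g) = 0.
Proof.
by move=> gP gy yz; apply: proj_eq0; rewrite (pclassE gP); exact: (rel_C1 (G := HGraph gP) gy yz).
Qed.

(** Only dotted edges between different trees become solid, so one with both ends at the same vertex
    survives every join, and C1 kills each final term. *)
Lemma self_edge k r (g : pregraph H n k.+2) : hairy_lie (k.+1 + r) g ->
  (exists y b z, att g y = Dotted H b z /\ y.1 = z.1) ->
  to_omega (beta_iter (k := k.+1) (pclass (k.+1 + r) g)) = 0.
Proof.
have keep k' (g' : pregraph H n k'.+2) h b h' r' : hairy_lie r' g' ->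
    (exists y b z, att g' y = Dotted H b z /\ y.1 = z.1) ->
    att g' h = Dotted H b h' -> tree g' h.1 = 0 :> nat ->
    tree g' h'.1 = 1%N :> nat ->
    exists y b z, att (join h h' g') y = Dotted H b z /\ y.1 = z.1.
  move=> gP [y [c [z [gy yz]]]] gh th th'; exists y, c, z; split=> //.
  have [cg _ _ _] := hairyP _ _ gP; have [gh' _] := consistent_dotted cg gh.
  rewrite ffunE; case: eqP => [e|_].
    by move: gy th'; rewrite e gh => -[_ e']; rewrite e' -yz e th.
  case: eqP => [e|//].
  by move: gy th'; rewrite e gh' => -[_ e']; rewrite -e yz -e' th.
move: k g; apply: (@beta_iter_ind r (fun k g =>
  exists y b z, att g y = Dotted H b z /\ y.1 = z.1)).
- by move=> k g h b h' gP; apply: keep gP.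
- move=> g gP Q; rewrite linear_sum big1 // => y _.
  apply: (beta_ptermP (P := fun v => to_omega v = 0)) => [|b z gy ty tz].
    by rewrite linear0.
  have [x [c [w [gx xw]]]] := keep _ _ _ _ _ _ gP Q gy ty tz.
  by rewrite linearZ /= (C1_pclass (join_hairy gP gy ty tz) gx xw) scaler0.
Qed.

Lemma ord_max_ne0 (i : 'I_2) : i != ord_max -> i = 0 :> nat.
Proof. by case: i => -[|[|i]]. Qed.

Lemma join_sym k (g : pregraph H n k.+2) h h' : h != h' -> join h h' g = join h' h g.
Proof.
move=> hh; congr Pregraph; apply/ffunP => y; rewrite !ffunE.
by case: eqP => [->|//]; rewrite (negPf hh).
Qed.

Lemma join_preserves_last k (g : pregraph H n k.+3) h b h' y z :
  consistent g -> att g h = Dotted H b h' -> tree g h.1 = 0 :> nat ->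
  tree g h'.1 = 1%N :> nat -> att g y = Dotted H true z ->
  tree g y.1 = ord_max -> tree g z.1 != ord_max ->
  [/\ att (join h h' g) y = Dotted H true z, tree (join h h' g) y.1 = ord_max
    & tree (join h h' g) z.1 != ord_max].
Proof.
move=> cg gh th th' gy ty tz; rewrite join_att_last //; split=> //.
  by rewrite ffunE; apply/eqP; rewrite merge_last ty.
by rewrite ffunE merge_last.
Qed.

(* The two final terms agree up to sign: C2 slides the branch at [next t] from
   one of the dotted edges to the other. *)
Lemma two_joins r (g : pregraph H n 2) t p q :
  hairy_lie r.+1 g ->
  att g t = Dotted H true p -> att g (next (next t)) = Dotted H true q ->
  tree g t.1 = ord_max -> tree g p.1 != ord_max -> tree g q.1 != ord_max ->
  (forall y, is_dotted (att g y) -> tree g y.1 = ord_max ->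
     y = t \/ y = next (next t)) ->
  to_omega (pclass r (join p t g)) + to_omega (pclass r (join q (next (next t)) g)) = 0.
Proof.
move=> gP gt gc tt tp tq last; have [cg _ _ _] := hairyP _ _ gP.
have [gp tNp] := consistent_dotted cg gt; have [gq cNq] := consistent_dotted cg gc.
have tc : next (next t) != t := next2_neq t.
have pq : p != q by apply: contraNneq tc => e; move: gp; rewrite e gq => -[->].
have pN y : tree g y.1 = ord_max -> (y == p = false) * (y == q = false).
  by move=> ty; split; apply/eqP => e; [move: tp|move: tq]; rewrite -e ty eqxx.
have t1 : tree g t.1 = 1%N :> nat by rewrite tt.
have g1P : hairy_lie r (join p t g).
  by apply: (join_hairy gP gp (ord_max_ne0 tp) t1).
have g2P : hairy_lie r (join q (next (next t)) g).
  by apply: (join_hairy gP gq (ord_max_ne0 tq) t1).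
set g1 := join p t g in g1P *; set g2 := join q _ g in g2P *.
have [cg1 _ _ _] := hairyP _ _ g1P.
have g1t : att g1 t = Solid H p by rewrite ffunE (pN t tt).1 eqxx.
have g1c : att g1 (next (next t)) = Dotted H true q.
  by rewrite ffunE (pN (next (next t)) tt).1 (negPf tc).
have g1S y z : y != t -> y != p -> att g1 y = Solid H z -> att g y = Solid H z.
  by rewrite ffunE => /negPf-> /negPf->.
have [d [d0 strict unique]] := tree_depth t.1 g1P.
(* [A] selects [next t] and the half-edges of the last tree away from the vertex of [t]; by [last]
   none of them is dotted. *)
have [||||s bs] := branch_exists (A := fun y => (tree g y.1 == ord_max) &&
    ((y == next t) || (0 < d y.1)%N)) (h := next t) cg1 strict unique.
- move=> y b /andP[/eqP ty yt] ly gy; have [hb _ _] := lower_child cg1 strict unique gy ly.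
  have d_b : (0 < d b.1)%N by apply: leq_ltn_trans hb.
  have yp : y != p by rewrite (pN y ty).1.
  have yNt : y != t.
    by apply: contraTneq yt => ->; rewrite d0 ltnn orbF eq_sym next_neq.
  have [_ _ tb] := consistent_solid cg (g1S _ _ yNt yp gy).
  by rewrite /= tb ty eqxx d_b !orbT.
- move=> y /andP[/eqP ty yt]; apply/negP; rewrite ffunE (pN y ty).1.
  case: eqP => [//|yNt] gy; case: (last y gy ty) => // e.
  by move: yt; rewrite e /= d0 ltnn (negPf (next_neq _)).
- by rewrite /= tt !eqxx.
- by rewrite /lower /=; case: (att g1 (next t)) => // z; rewrite d0.
rewrite (omega_slide g1P g1t g1c bs) -(slide_relabel g1P g1t g1c).
have g2p : att g2 p = Dotted H false t.
  by rewrite ffunE (negPf pq) eq_sym (pN (next (next t)) tt).1 gp.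
(* Sliding yields the other joined graph, except that the remaining dotted edge has the opposite
   direction; this is the sign that cancels the two terms. *)
have -> : slide t p q g1 = reverse_edge p t g2.
  congr Pregraph; apply/ffunP => y; rewrite !ffunE.
  have cp : (p == next (next t)) = false by rewrite eq_sym (pN (next (next t)) tt).1.
  have [->|yp] := eqVneq y p; first by rewrite (negPf pq) cp gp.
  have [->|yt] := eqVneq y t; first by rewrite (pN t tt).2 eq_sym (negPf tc) gt.
  by have [->|//] := eqVneq y (next (next t)); rewrite (pN (next (next t)) tt).2.
have g2P' := reverse_edge_hairy g2P g2p.
by rewrite (pclass_direction g2P g2P' g2p erefl) raddfN subrr.
Qed.

Lemma two_edges_last k r (g : pregraph H n k.+2) t p q :
  hairy_lie (k.+1 + r) g ->
  att g t = Dotted H true p -> att g (next (next t)) = Dotted H true q ->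
  tree g t.1 = ord_max -> tree g p.1 != ord_max -> tree g q.1 != ord_max ->
  (forall y, is_dotted (att g y) -> tree g y.1 = ord_max ->
     y = t \/ y = next (next t)) ->
  to_omega (beta_iter (k := k.+1) (pclass (k.+1 + r) g)) = 0.
Proof.
move=> gP gt gc tt tp tq last.
pose Q k (g : pregraph H n k.+2) := [/\ att g t = Dotted H true p /\
  att g (next (next t)) = Dotted H true q, tree g t.1 = ord_max,
  tree g p.1 != ord_max, tree g q.1 != ord_max &
  forall y, is_dotted (att g y) -> tree g y.1 = ord_max ->
     y = t \/ y = next (next t)].
have : Q k g by split.
move: k g gP {gt gc tt tp tq last}; apply: (beta_iter_ind (Q := Q)).
- move=> k g h b h' gP [[gt gc] tt tp tq last] gh th th'.
  have [cg _ _ _] := hairyP _ _ gP.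
  have [gt' tt' tp'] := join_preserves_last cg gh th th' gt tt tp.
  have [gc' _ tq'] := join_preserves_last cg gh th th' gc tt tq.
  split=> // y gy ty; apply: last.
    by move: gy; rewrite ffunE; case: ifP => // _; case: ifP.
  by apply/eqP; rewrite -merge_last -ty ffunE.
- move=> g gP [[gt gc] tt tp tq last]; have [cg _ _ _] := hairyP _ _ gP.
  have [gp tNp] := consistent_dotted cg gt; have [gq cNq] := consistent_dotted cg gc.
  have tc : next (next t) != t := next2_neq t.
  have pq : p != q by apply: contraNneq tc => e; move: gp; rewrite e gq => -[->].
  (* [beta] sums over ends in the first tree, and only [p] and [q] lead to the last one. Both edges
     are directed towards the first tree, hence a common factor -1. *)
  rewrite (bigD1 p) // (bigD1 q) /=; last by rewrite eq_sym.
  rewrite big1 => [|y /andP[yp yq]]; last first.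
    apply: (beta_ptermP (P := fun v => v = 0)) => // b z gy ty tz.
    have [gz _] := consistent_dotted cg gy.
    have tz' : tree g z.1 = ord_max by apply: val_inj.
    have [||e|e] := last z; rewrite ?gz //.
      by move: gz yp; rewrite e gt => -[_ ->]; rewrite eqxx.
    by move: gz yq; rewrite e gc => -[_ ->]; rewrite eqxx.
  rewrite addr0 /beta_pterm gp gq /= (ord_max_ne0 tp) (ord_max_ne0 tq) tt /=.
  rewrite expr1 !scaleN1r -opprD raddfN raddfD /=.
  by rewrite (two_joins gP gt gc tt tp tq last) oppr0.
Qed.

End BetaIter.

(** * Three dotted edges, and absorption of the last tree *)

Section Vanishing.
Variables (H : lmodType rat) (n : nat).
Implicit Types (h y z : hedge n).

(* C3 has the tripod as first tree, hence the exchange of the two trees. *)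
Lemma three_joins r (g : pregraph H n 2) v (q : 'I_3 -> hedge n) :
  hairy_lie r.+1 g -> (forall i, att g (v, i) = Dotted H true (q i)) ->
  tree g v = ord_max -> (forall i, tree g (q i).1 != ord_max) ->
  to_omega (\sum_i pclass r (join (q i) (v, i) g)) = 0.
Proof.
move=> gP gq tv tq; have [cg /andP[/forallP ne /forallP con] _ _] := hairyP _ _ gP.
pose g' := Pregraph (att g) [ffun u => rev_ord (tree g u)].
have g'P : hairy_lie r.+1 g'.
  apply: retree_hairy gP => [u w|i]; first by rewrite !ffunE (inj_eq rev_ord_inj).
  have /existsP[u /eqP tu] := ne (rev_ord i); exists u.
  by rewrite ffunE tu rev_ordK.
have e i : join (q i) (v, i) g = join (v, i) (q i) g'.
  rewrite join_sym; last by apply/eqP => e; move: (tq i); rewrite e tv eqxx.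
  congr Pregraph; apply/ffunP => u; rewrite !ffunE.
  by apply: val_inj; rewrite !ord1.
under eq_bigr do rewrite e.
apply/proj_eq0; apply: (rel_C3 (G := HGraph g'P) (v := v)) => /=.
(* All half-edges at [v] are dotted, so no solid edge leaves [v] and its tree is a tripod. *)
- move=> u; rewrite ffunE; split => [|->]; last by rewrite tv.
  move=> tu; have tuv : tree g v == tree g u.
    by rewrite tv eq_sym; apply: contra_eqT tu => /ord_max_ne0 /= ->.
  have /forallP/(_ u)/implyP/(_ tuv) := con v.
  move/(connect_invariant (A := pred1 v)) => /= inv; apply/eqP/inv => //.
  by move=> _ _ /adjacentP[y [z [gy <- <-]]] /eqP yv; move: gy; rewrite [y]surjective_pairing yv gq.
- exact: gq.
- by move=> i; rewrite ffunE /= (ord_max_ne0 (tq i)).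
Qed.

Lemma three_edges_last k r (g : pregraph H n k.+2) v (q : 'I_3 -> hedge n) :
  hairy_lie (k.+1 + r) g -> (forall i, att g (v, i) = Dotted H true (q i)) ->
  tree g v = ord_max -> (forall i, tree g (q i).1 != ord_max) ->
  to_omega (beta_iter (k := k.+1) (pclass (k.+1 + r) g)) = 0.
Proof.
move=> gP gq tv tq.
pose Q k (g : pregraph H n k.+2) := [/\ forall i, att g (v, i) = Dotted H true (q i),
  tree g v = ord_max & forall i, tree g (q i).1 != ord_max].
have : Q k g by split.
move: k g gP {gq tv tq}; apply: (beta_iter_ind (Q := Q)).
- move=> k g h b h' gP [gq tv tq] gh th th'; have [cg _ _ _] := hairyP _ _ gP.
  have keep i := join_preserves_last cg gh th th' (gq i) tv (tq i).
  by split=> [i||i]; [have [] := keep i|have [] := keep ord0|have [] := keep i].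
- move=> g gP [gq tv tq]; have [cg _ _ _] := hairyP _ _ gP.
  have gq' i : att g (q i) = Dotted H false (v, i).
    by have [] := consistent_dotted cg (gq i).
  have qI : injective q by move=> i j e; have := gq' i; rewrite e gq' => -[].
  (* The last tree is the single vertex [v], so every dotted edge between the two trees starts at
     one of the [q i]. *)
  rewrite (bigID (mem [set q i | i in 'I_3])) /= big_imset /=; last by move=> i j _ _ /qI.
  rewrite [X in _ + X]big1 => [|y yq]; last first.
    apply: (beta_ptermP (P := fun w => w = 0)) => // b z gy ty tz.
    have [gz _] := consistent_dotted cg gy; case/negP: yq; apply/imsetP.
    have tvz : tree g v == tree g z.1 by rewrite tv; apply/eqP/val_inj; rewrite /= tz.
    have [_ /andP[_ /forallP/(_ v)/forallP/(_ z.1)/implyP/(_ tvz) con] _ _] := hairyP _ _ gP.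
    have zv : z.1 = v.
      apply/eqP; apply: (connect_invariant (A := pred1 v)) con _ => /=; last exact: eqxx.
      move=> _ _ /adjacentP[x [w [gx <- <-]]] /eqP xv.
      by move: gx; rewrite [x]surjective_pairing xv gq.
    exists z.2 => //; have := gq z.2; rewrite -zv -surjective_pairing gz.
    by case.
  rewrite addr0 (eq_big xpredT (fun i => - pclass r (join (q i) (v, i) g))) => [|//|i _].
    by rewrite sumrN raddfN /= (three_joins gP gq tv tq) oppr0.
  by rewrite /beta_pterm gq' (ord_max_ne0 (tq i)) tv expr1 scaleN1r.
Qed.

(** The only dotted edge leaving the last tree is the one made solid in the final step, and making
    it solid first commutes with the other joins. The sign is -1 when the edge is directed away from
    the last tree, which is the second tree in that step. *)
Lemma beta_absorb_last k r (g : pregraph H n k.+2) h b h' :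
  hairy_lie (k.+1 + r) g -> att g h = Dotted H b h' ->
  tree g h.1 = ord_max -> tree g h'.1 != ord_max ->
  (forall y, is_dotted (att g y) -> tree g y.1 = ord_max -> y = h) ->
  beta_iter (k := k.+1) (pclass (k.+1 + r) g) =
    (-1) ^+ b *: beta_iter (pclass (k + r) (absorb_last h h' g)).
Proof.
elim: k g => [|k IH] g gP gh th th' last; rewrite [LHS]/= (beta_pclass gP).
  have [cg _ _ _] := hairyP _ _ gP; have [gh' hh'] := consistent_dotted cg gh.
  rewrite (bigD1 h') //= big1 => [|y yh]; last first.
    apply: (beta_ptermP (P := fun v => v = 0)) => // c z gy ty tz.
    have [gz _] := consistent_dotted cg gy.
    have e : z = h by apply: last; [rewrite gz|apply: val_inj].
    by move: gz yh; rewrite e gh => -[_ ->]; rewrite eqxx.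
  rewrite addr0 /beta_pterm gh' (ord_max_ne0 th') th /= negbK; congr (_ *: pclass _ _).
  rewrite join_sym //; congr Pregraph; apply/ffunP => u.
  by rewrite !ffunE; apply: val_inj; rewrite !ord1.
have [cg _ _ _] := hairyP _ _ gP; have [gh' hh'] := consistent_dotted cg gh.
have aP := absorb_last_hairy gP gh th th'.
rewrite /= (beta_pclass aP) !linear_sum; apply: eq_bigr => y _ /=.
(* With at least three trees the last one is neither first nor second, so [h] and [h'] contribute
   nothing; after absorption they are solid. *)
have hN : beta_pterm (k.+1 + r) g h = 0 by rewrite /beta_pterm gh th.
have h'N : beta_pterm (k.+1 + r) g h' = 0 by rewrite /beta_pterm gh' th /= andbF.
have [->|yh] := eqVneq y h.
  by rewrite hN linear0 /beta_pterm ffunE eqxx linear0 ?scaler0.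
have [->|yh'] := eqVneq y h'.
  by rewrite h'N linear0 /beta_pterm ffunE (negPf hh') eqxx linear0 ?scaler0.
have aE : att (absorb_last h h' g) y = att g y.
  by rewrite ffunE (negPf yh) (negPf yh').
case gy: (att g y) => [z|c z|x]; try by rewrite /beta_pterm aE gy !linear0 ?scaler0.
have [gz _] := consistent_dotted cg gy.
have zh : z != h by apply: contraNneq yh' => e; move: gz; rewrite e gh => -[_ ->].
have zh' : z != h' by apply: contraNneq yh => e; move: gz; rewrite e gh' => -[_ ->].
have ty : tree g y.1 != ord_max.
  by apply: contraNneq yh => /(last y) -> //; rewrite gy.
have tz : tree g z.1 != ord_max.
  by apply: contraNneq zh => /(last z) -> //; rewrite gz.
have inordE m (i : 'I_m.+2) : i != ord_max -> (inord i : 'I_m.+1) = i :> nat.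
  by move=> im; rewrite inordK // ltn_neqAle im -ltnS ltn_ord.
rewrite /beta_pterm aE gy /= !ffunE (negPf ty) (negPf tz) !inordE //.
case: ifP => [/andP[/eqP ty0 /eqP tz1]|_]; last by rewrite !linear0 ?scaler0.
rewrite !linearZ; congr (_ *: _).
have jP := join_hairy gP gy ty0 tz1.
have jh : att (join y z g) h = Dotted H b h'.
  by rewrite ffunE eq_sym (negPf yh) eq_sym (negPf zh).
have jth : tree (join y z g) h.1 = ord_max.
  by apply/eqP; rewrite ffunE merge_last th.
have jth' : tree (join y z g) h'.1 != ord_max by rewrite ffunE merge_last.
apply: etrans (IH _ jP jh jth jth' _) _ => [x|].
  rewrite ffunE => gx; rewrite ffunE => /eqP; rewrite merge_last => /eqP; apply: last.
  by move: gx; case: ifP => // _; case: ifP.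
congr (_ *: beta_iter (pclass _ _)); congr Pregraph; apply/ffunP => u; rewrite !ffunE.
  have [->|uh] := eqVneq u h; first by rewrite eq_sym (negPf yh) eq_sym (negPf zh).
  by have [->|//] := eqVneq u h'; rewrite eq_sym (negPf yh') eq_sym (negPf zh').
rewrite merge_last; apply: val_inj; rewrite /= [in RHS]merge_val /=.
by case: eqP => [_|/eqP um]; rewrite !inordE ?merge_val // merge_last.
Qed.

End Vanishing.

(** * Graphs with dotted edges at one vertex of each tree *)

Section Image.
Variables (H : lmodType rat) (n : nat).
Implicit Types (h y z : hedge n).

Lemma dottedP (p : port H n) :
  reflect (exists b z, p = Dotted H b z) (is_dotted p).
Proof. by apply: (iffP idP) => [|[b [z ->]] //]; case: p => // b z; exists b, z. Qed.

Lemma vanishZ k r a (x : C H k.+1 (k + r) n) :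
  to_omega (beta_iter x) = 0 -> to_omega (beta_iter (a *: x)) = 0.
Proof. by move=> x0; rewrite !linearZ /= x0 scaler0. Qed.

(** [orient] directs both dotted edges away from the last tree, at the cost of scalars that do not
    affect vanishing. *)
Lemma two_dotted_last k r (g : pregraph H n k.+2) t p q b c :
  hairy_lie (k.+1 + r) g ->
  att g t = Dotted H b p -> att g (next (next t)) = Dotted H c q ->
  tree g t.1 = ord_max -> tree g p.1 != ord_max -> tree g q.1 != ord_max ->
  (forall y, is_dotted (att g y) -> tree g y.1 = ord_max ->
     y = t \/ y = next (next t)) ->
  to_omega (beta_iter (k := k.+1) (pclass (k.+1 + r) g)) = 0.
Proof.
move=> gP gt gc tt tp tq last; have tc := next2_neq t.
have ne y z : tree g y.1 = ord_max -> tree g z.1 != ord_max -> y != z.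
  by move=> ty; apply: contraNneq => <-; rewrite ty.
have [g1 [e1 [g1P [-> t1] g1t d1 a1]]] := orient gP gt.
have g1c : att g1 (next (next t)) = Dotted H c q by rewrite a1 // ne.
have [g2 [e2 [g2P [-> t2] g2c d2 a2]]] := orient g1P g1c.
have g2t : att g2 t = Dotted H true p by rewrite a2 //; [rewrite eq_sym|apply: ne].
do 2![apply: vanishZ]; apply: (two_edges_last g2P g2t g2c); rewrite t2 t1 //.
by move=> y; rewrite d2 d1; apply: last.
Qed.

Lemma three_dotted_last k r (g : pregraph H n k.+2) t p q s b c d :
  hairy_lie (k.+1 + r) g ->
  att g t = Dotted H b p -> att g (next t) = Dotted H c q ->
  att g (next (next t)) = Dotted H d s -> tree g t.1 = ord_max ->
  tree g p.1 != ord_max -> tree g q.1 != ord_max -> tree g s.1 != ord_max ->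
  to_omega (beta_iter (k := k.+1) (pclass (k.+1 + r) g)) = 0.
Proof.
move=> gP gt gn gc tt tp tq ts.
have tn := next_neq t; have tc := next2_neq t; have nc := next_neq (next t).
have ne y z : tree g y.1 = ord_max -> tree g z.1 != ord_max -> y != z.
  by move=> ty; apply: contraNneq => <-; rewrite ty.
have [g1 [e1 [g1P [-> t1] g1t _ a1]]] := orient gP gt.
have g1n : att g1 (next t) = Dotted H c q by rewrite a1 // ne.
have g1c : att g1 (next (next t)) = Dotted H d s by rewrite a1 // ne.
have [g2 [e2 [g2P [-> t2] g2n _ a2]]] := orient g1P g1n.
have g2t : att g2 t = Dotted H true p by rewrite a2 //; [rewrite eq_sym|apply: ne].
have g2c : att g2 (next (next t)) = Dotted H d s by rewrite a2 // ne.
have [g3 [e3 [g3P [-> t3] g3c _ a3]]] := orient g2P g2c.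
have g3t : att g3 t = Dotted H true p by rewrite a3 //; [rewrite eq_sym|apply: ne].
have g3n : att g3 (next t) = Dotted H true q by rewrite a3 //; [rewrite eq_sym|apply: ne].
do 3![apply: vanishZ].
have mate i : exists z, att g3 (t.1, i) = Dotted H true z /\ tree g z.1 != ord_max.
  by have [->|->|->] := same_vertex (erefl : (t.1, i).1 = t.1); eexists; split; eauto.
apply: (three_edges_last (v := t.1) (q := fun i => projT1 (cid (mate i))) g3P).
- by move=> i; case: cid => z [].
- by rewrite t3 t2 t1.
- by move=> i; case: cid => z []; rewrite t3 t2 t1.
Qed.

(** The hypothesis survives absorption, as consisting of tripods would not: the absorbed tree loses
    its only dotted edge, so all remaining ones come from the other trees. With [r.+1] a dotted edge
    is left at the end for C1. *)
Lemma concentrated_vanish k r (g : pregraph H n k.+1) : hairy_lie (k + r.+1) g ->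
  (forall y z, is_dotted (att g y) -> is_dotted (att g z) ->
     tree g y.1 = tree g z.1 -> y.1 = z.1) ->
  to_omega (beta_iter (pclass (k + r.+1) g)) = 0.
Proof.
elim: k g => [|k IH] g gP conc; have [cg _ _ dg] := hairyP _ _ gP.
  have : (0 < #|[set h | is_dotted (att g h)]|)%N by rewrite dg.
  case/card_gt0P => y; rewrite inE; case gy: (att g y) => [|b z|] // _.
  apply: (C1_pclass gP gy); have [gz _] := consistent_dotted cg gy.
  by apply: conc; rewrite ?gy ?gz // !ord1.
have [self|Nself] := pselect (exists y b z, att g y = Dotted H b z /\ y.1 = z.1).
  exact: self_edge gP self.
have mate_out y b z : att g y = Dotted H b z -> tree g y.1 = ord_max -> tree g z.1 != ord_max.
  move=> gy ty; apply/eqP => tz; apply: Nself; exists y, b, z; split=> //.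
  have [gz _] := consistent_dotted cg gy.
  by apply: conc; rewrite ?gy ?gz // ty tz.
have [[h [hd th]]|none] := pselect (exists h, is_dotted (att g h) /\ tree g h.1 = ord_max);
    last first.
  apply: (no_edge_to_last gP) => y b z gy ty; case: none; exists y.
  by rewrite gy.
have at_h y : is_dotted (att g y) -> tree g y.1 = ord_max ->
    [\/ y = h, y = next h | y = next (next h)].
  by move=> dy ty; apply/same_vertex/conc; rewrite ?th.
have /dottedP[b [h' gh]] := hd; have th' := mate_out _ _ _ gh th.
have [/dottedP[c [y gn]]|nn] := boolP (is_dotted (att g (next h)));
  have [/dottedP[d [z gc]]|nc] := boolP (is_dotted (att g (next (next h)))).
- apply: (three_dotted_last gP gh gn gc) => //.
    exact: mate_out gn _.
  exact: mate_out gc _.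
(* Here [next h] plays the role of [t], so that [next (next t)] is [h] and the free branch starts at
   [next t]. *)
- have gh3 : att g (next (next (next h))) = Dotted H b h' by rewrite next3.
  apply: (two_dotted_last gP gn gh3 th (mate_out _ _ _ gn th) th').
  move=> x dx /(at_h x dx)[]; rewrite ?next3; [by right|by left|].
  by move=> e; rewrite -e dx in nc.
- apply: (two_dotted_last gP gh gc th th' (mate_out _ _ _ gc th)).
  move=> x dx /(at_h x dx)[]; [by left| |by right].
  by move=> e; rewrite -e dx in nn.
have last y : is_dotted (att g y) -> tree g y.1 = ord_max -> y = h.
  move=> dy ty; have [//|e|e] := at_h y dy ty.
    by rewrite -e dy in nn.
  by rewrite -e dy in nc.
rewrite (beta_absorb_last gP gh th th' last) linearZ /=.
rewrite IH ?scaler0 //; first exact: absorb_last_hairy gP gh th th'.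
have dE y : is_dotted (att (absorb_last h h' g) y) ->
    is_dotted (att g y) /\ tree g y.1 != ord_max.
  rewrite ffunE; case: eqP => // /eqP yh; case: eqP => // _ dy; split=> //.
  by apply: contraNneq yh => /(last y dy) ->.
move=> y z /dE[dy ty] /dE[dz tz]; rewrite !ffunE (negPf ty) (negPf tz).
have lt (i : 'I_k.+2) : i != ord_max -> (i < k.+1)%N.
  by move=> im; rewrite ltn_neqAle im -ltnS ltn_ord.
move/(congr1 val); rewrite /= !inordK ?lt // => /val_inj.
exact: conc.
Qed.

End Image.

(** There are as many trees as vertices and none is empty, so each tree is a tripod. *)
Lemma tree_inj (H : lmodType rat) k r (g : pregraph H k k) :
  hairy_lie r g -> injective (tree g).
Proof.
case/hairyP=> _ /andP[/forallP ne _] _ _.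
have /image_injP inj : #|image (tree g) 'I_k| == #|'I_k|.
  rewrite (eq_card (B := 'I_k)) // => i; rewrite [RHS]inE.
  by have /existsP[u /eqP <-] := ne i; apply: image_f.
by move=> u v; apply: inj.
Qed.

(** By linearity a single generator suffices; its trees are tripods, so its dotted edges are
    trivially concentrated at one vertex of each tree. *)
Lemma omega_image_beta (H : lmodType rat) r m (y : C H 1 r.+1 m.+1) :
  image_beta y -> proj (@omega_relation H r.+1 m.+1) y = 0.
Proof.
case=> x ->; change (to_omega (beta_iter x) = 0).
elim/proj_ind: x => D; rewrite -[D]freeg_sumE !linear_sum big1 //= => G _.
have -> : << coeff G D *g G >> = coeff G D *: << G >>.
  by apply/eqP/freeg_eqP => z; rewrite coeffZ !coeffU mul1r.
rewrite linearZ; apply: vanishZ.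
change (to_omega (beta_iter (gclass G)) = 0).
rewrite -pclass_hg; apply: concentrated_vanish; first exact: hgP.
by move=> u v _ _ /(tree_inj (hgP G)).
Qed.

(** * Componentwise maps of direct sums, and the factorization of the trace *)

Section DsumMap.
Variables (R : nzRingType) (I : eqType) (V W : I -> lmodType R).
Variable f : forall i, {linear V i -> W i}.

Lemma dsum_map_fin (x : dsum V) :
  exists s : seq I, forall i, i \notin s -> f i (x i) = 0.
Proof. by have [s xs] := component_fin x; exists s => i /xs ->; rewrite linear0. Qed.

Definition dsum_map (x : dsum V) : dsum W := DSum (dsum_map_fin x).

Lemma dsum_map_is_linear : linear dsum_map.
Proof. by move=> a x y; apply: dsumP => i /=; rewrite linearP. Qed.
HB.instance Definition _ := GRing.isLinear.Build R (dsum V) (dsum W) *:%R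
  dsum_map dsum_map_is_linear.

Lemma dsum_map_in i (v : V i) : dsum_map (dsum_in v) = dsum_in (f i v).
Proof.
apply: dsumP => j /=; have [ij|ij] := eqVneq i j.
  by subst j; rewrite !dfwith_in.
by rewrite !dfwith_out // linear0.
Qed.
End DsumMap.

Theorem proposition5p2 (g : nat) (H : vectType rat) (omega : {skew_symmetric H})
    (dimH : \dim {:H} = (2 * g)%N) (omega_nondeg : nondegenerate omega) :
  exists phi : {linear Omega_tilde_total H -> Omega_total H},
    (forall m s (x : C H 1 s.+1 m.+1), phi (in_Omega_tilde x) = in_Omega x) /\
    (forall x : h_total H, phi (trace_tilde omega x) = trace_C omega x).
Proof.
(* Since the image of the iterated [beta] dies in [Omega], the projection to [Omega] factors through
   [Omega_tilde] in each bidegree. *)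
pose psi (i : nat * nat) :
    {linear Omega_tilde H i.2.+1 i.1 -> Omega H i.2.+1 i.1} :=
  qlift (f := proj (@omega_relation H i.2.+1 i.1.+1)) (@omega_image_beta H i.2 i.1).
exists (dsum_map psi); split=> [m s x|x].
  rewrite /= /in_Omega_tilde dsum_map_in; congr dsum_in.
  exact: qliftE.
by apply: dsumP => i; exact: qliftE.
Qed.
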